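(* If $T$ is sufficiently large, then uniformly for all positive integers $\ell \leqslant (\log T)/(\log_2 T)$, we have $$\max_{T\leqslant t\leqslant 2T}\left|\zeta^{(\ell)}(1+it)\right| \geqslant e^{\gamma}\cdot \ell^{\ell}\cdot (\ell+1)^{-(\ell+1)}\cdot\Big(\log_2 T - \log_3 T + O(1)\Big)^{\ell+1},$$ where the threshold for $T$ and the bound implicit in $O(1)$ are absolute (independent of $\ell$ and $T$).
   Context: $\zeta$ is the Riemann zeta function and $\zeta^{(\ell)}$ its $\ell$-th derivative. $\gamma$ is the Euler constant. Notation: $\log_2 T := \log\log T$ and $\log_3 T := \log\log\log T$ (iterated natural logarithms). *)

(* Defs.v *)
From Stdlib Require Import Reals Lra Lia Psatz.
From Coquelicot Require Import Coquelicot.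
Open Scope R_scope.

Definition Cexp (z : C) : C := (exp (Re z) * cos (Im z), exp (Re z) * sin (Im z)).

(** Meant for a real base [x > 0]: the principal value of [x ^ s]. *)
Definition rcpow (x : R) (s : C) : C := Cexp (RtoC (ln x) * s)%C.

Definition zeta_approx (N : nat) (s : C) : C :=
  Cplus (sum_n (fun n => rcpow (INR (S n)) (- s)) N)
        (rcpow (INR (S N)) (1 - s) / (s - 1))%C.

(** The Riemann zeta function on the half-plane [0 < Re s], [s <> 1], as
    [lim (1 ^ (-s) + ... + N ^ (-s) + N ^ (1 - s) / (s - 1))] for [N] to infinity.
    Theorem [zeta_is_continuation] below proves that this is the (unique, the region
    being connected) analytic continuation of the Dirichlet series.  Values at
    [Re s <= 0] or [s = 1] are meaningless. *)
Definition zeta (s : C) : C :=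
  (real (Lim_seq (fun N => Re (zeta_approx N s))),
   real (Lim_seq (fun N => Im (zeta_approx N s)))).

Definition is_Dirichlet_continuation (f : C -> C) : Prop :=
  (forall s : C, 1 < Re s ->
     @is_series C_AbsRing C_NormedModule (fun n => rcpow (INR (S n)) (- s)) (f s)) /\
  (forall s : C, 0 < Re s -> s <> 1%C ->
     @ex_derive C_AbsRing C_NormedModule f s).

(** Iterated complex derivative, the analogue of [Derive_n].  [C_derive] is total and
    equals the complex derivative wherever the latter exists ([is_C_derive_unique]). *)
Fixpoint C_derive_n (f : C -> C) (n : nat) (s : C) : C :=
  match n with
  | O => f s
  | S p => C_derive (C_derive_n f p) s
  end.

(** The limit exists by [is_lim_euler_gamma] below. *)
Definition euler_gamma : R :=
  real (Lim_seq (fun n => sum_n (fun k => / INR (S k)) n - ln (INR (S n)))).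

Definition is_max_on (f : R -> R) (a b M : R) : Prop :=
  (exists t, a <= t <= b /\ f t = M) /\ (forall t, a <= t <= b -> f t <= M).

(** Derivative of a complex-valued function of a real variable. *)
Definition Dr (F : R -> C) (x : R) (l : C) : Prop :=
  is_derive (fun y => Re (F y)) x (Re l) /\ is_derive (fun y => Im (F y)) x (Im l).

Lemma Cmod_le_ReIm (z : C) : Cmod z <= Rabs (Re z) + Rabs (Im z).
Proof.
destruct z as [a b]; unfold Cmod; simpl.
rewrite <- (sqrt_Rsqr (Rabs a + Rabs b)).
2: { pose proof (Rabs_pos a); pose proof (Rabs_pos b); lra. }
apply sqrt_le_1_alt; unfold Rsqr.
replace (a * (a * 1)) with (Rabs a * Rabs a) by (rewrite <- Rabs_mult, Rabs_pos_eq; nra).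
replace (b * (b * 1)) with (Rabs b * Rabs b) by (rewrite <- Rabs_mult, Rabs_pos_eq; nra).
pose proof (Rabs_pos a); pose proof (Rabs_pos b); nra.
Qed.

Lemma im_le_Cmod (z : C) : Rabs (Im z) <= Cmod z.
Proof.
eapply Rle_trans; [apply Rmax_r | apply Rmax_Cmod].
Qed.

Lemma Cmod_minus_le (a b : C) : Cmod (a - b) <= Cmod a + Cmod b.
Proof.
unfold Cminus; eapply Rle_trans; [apply Cmod_triangle|]; rewrite Cmod_opp; lra.
Qed.

Lemma mvtC (F dF : R -> C) a b B : a <= b ->
  (forall x, a <= x <= b -> Dr F x (dF x)) ->
  (forall x, a <= x <= b -> Cmod (dF x) <= B) ->
  Cmod (F b - F a) <= 2 * B * (b - a).
Proof.
intros Hab HD HB.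
assert (H : forall p : C -> R, (forall z, Rabs (p z) <= Cmod z) ->
  (forall x, a <= x <= b -> is_derive (fun y => p (F y)) x (p (dF x))) ->
  Rabs (p (F b) - p (F a)) <= B * (b - a)).
{ intros p Hp Hd.
  destruct (MVT_gen (fun y => p (F y)) a b (fun y => p (dF y))) as [c [Hc E]].
  - rewrite Rmin_left, Rmax_right by lra. intros; apply Hd; lra.
  - rewrite Rmin_left, Rmax_right by lra. intros x Hx.
    apply continuity_pt_filterlim, (@ex_derive_continuous R_AbsRing R_NormedModule).
    eexists; apply Hd; lra.
  - rewrite Rmin_left, Rmax_right in Hc by lra.
    cbv beta in E; rewrite E, Rabs_mult, (Rabs_pos_eq (b - a)) by lra.
    apply Rmult_le_compat_r; [lra|].
    eapply Rle_trans; [apply Hp | apply HB; lra]. }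
eapply Rle_trans; [apply Cmod_le_ReIm|].
assert (H1 := H Re re_le_Cmod (fun x h => proj1 (HD x h))).
assert (H2 := H Im im_le_Cmod (fun x h => proj2 (HD x h))).
unfold Cminus; rewrite re_plus, im_plus, re_opp, im_opp.
unfold Rminus in *; lra.
Qed.

Lemma Dr_eq F x l l' : Dr F x l -> l = l' -> Dr F x l'.
Proof. intros H <-; exact H. Qed.

Lemma Dr_const (c : C) x : Dr (fun _ => c) x 0%C.
Proof. split; apply (@is_derive_const R_AbsRing R_NormedModule). Qed.

Lemma Dr_real (f : R -> R) x l : is_derive f x l -> Dr (fun y => RtoC (f y)) x (RtoC l).
Proof. intros H; split; simpl; [exact H|apply (@is_derive_const R_AbsRing R_NormedModule)]. Qed.

Lemma Dr_plus F G x l k : Dr F x l -> Dr G x k -> Dr (fun y => F y + G y)%C x (l + k)%C.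
Proof.
intros [H1 H2] [H3 H4]; split.
- apply (is_derive_plus (fun y => Re (F y)) (fun y => Re (G y))); assumption.
- apply (is_derive_plus (fun y => Im (F y)) (fun y => Im (G y))); assumption.
Qed.

Lemma is_derive_mult_R (f g : R -> R) x a b : is_derive f x a -> is_derive g x b ->
  is_derive (fun y => f y * g y) x (a * g x + f x * b).
Proof. intros H1 H2; apply (is_derive_mult f g x a b H1 H2); intros; apply Rmult_comm. Qed.

Lemma is_derive_eq_R (f : R -> R) (x a b : R) : is_derive f x a -> a = b -> is_derive f x b.
Proof. intros H <-; exact H. Qed.

Lemma Dr_mult F G x l k : Dr F x l -> Dr G x k ->
  Dr (fun y => F y * G y)%C x (l * G x + F x * k)%C.
Proof.
intros [H1 H2] [H3 H4]; split.
- eapply is_derive_ext; [intros t; symmetry; apply re_mult|].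
  eapply is_derive_eq_R.
  + apply (@is_derive_minus R_AbsRing R_NormedModule); apply is_derive_mult_R; eassumption.
  + rewrite re_plus, !re_mult; match goal with |- minus ?a ?b = _ => change (a - b = Re l * Re (G x) - Im l * Im (G x) + (Re (F x) * Re k - Im (F x) * Im k)) end; ring.
- eapply is_derive_ext; [intros t; symmetry; apply im_mult|].
  eapply is_derive_eq_R.
  + apply (@is_derive_plus R_AbsRing R_NormedModule); apply is_derive_mult_R; eassumption.
  + rewrite im_plus, !im_mult; match goal with |- plus ?a ?b = _ => change (a + b = Re l * Im (G x) + Im l * Re (G x) + (Re (F x) * Im k + Im (F x) * Re k)) end; ring.
Qed.

Lemma Dr_scal (c : C) F x l : Dr F x l -> Dr (fun y => c * F y)%C x (c * l)%C.
Proof.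
intros H; eapply Dr_eq; [apply Dr_mult; [apply Dr_const | apply H]|]; cbv beta; ring.
Qed.

Lemma Dr_opp F x l : Dr F x l -> Dr (fun y => - F y)%C x (- l)%C.
Proof.
intros [H1 H2]; split.
- apply (is_derive_opp (fun y => Re (F y))); assumption.
- apply (is_derive_opp (fun y => Im (F y))); assumption.
Qed.

Lemma Dr_minus F G x l k : Dr F x l -> Dr G x k -> Dr (fun y => F y - G y)%C x (l - k)%C.
Proof. intros H1 H2; apply Dr_plus; [|apply Dr_opp]; assumption. Qed.

Lemma Dr_Cexp F x l : Dr F x l -> Dr (fun y => Cexp (F y)) x (l * Cexp (F x))%C.
Proof.
intros [H1 H2].
assert (He : is_derive (fun y => exp (Re (F y))) x (Re l * exp (Re (F x)))).
{ apply (@is_derive_comp R_AbsRing R_NormedModule exp); [apply is_derive_exp|exact H1]. }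
assert (Hc : is_derive (fun y => cos (Im (F y))) x (Im l * - sin (Im (F x)))).
{ apply (@is_derive_comp R_AbsRing R_NormedModule cos); [apply is_derive_cos|exact H2]. }
assert (Hs : is_derive (fun y => sin (Im (F y))) x (Im l * cos (Im (F x)))).
{ apply (@is_derive_comp R_AbsRing R_NormedModule sin); [apply is_derive_sin|exact H2]. }
split.
- eapply is_derive_eq_R; [apply (is_derive_mult_R _ _ _ _ _ He Hc)|].
  unfold Cexp; simpl; unfold Re, Im; simpl; ring.
- eapply is_derive_eq_R; [apply (is_derive_mult_R _ _ _ _ _ He Hs)|].
  unfold Cexp; simpl; unfold Re, Im; simpl; ring.
Qed.

Lemma Cmod_Cexp z : Cmod (Cexp z) = exp (Re z).
Proof.
unfold Cmod, Cexp; simpl.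
replace (_ + _) with (Rsqr (exp (Re z))).
- rewrite sqrt_Rsqr; [reflexivity|left; apply exp_pos].
- pose proof (sin2_cos2 (Im z)) as H; unfold Rsqr in *.
  transitivity (exp (Re z) * exp (Re z) * (sin (Im z) * sin (Im z) + cos (Im z) * cos (Im z))); [rewrite H|]; ring.
Qed.

Lemma Cexp_plus a b : Cexp (a + b)%C = (Cexp a * Cexp b)%C.
Proof.
unfold Cexp; rewrite re_plus, im_plus, exp_plus, cos_plus, sin_plus.
unfold Cmult; simpl; f_equal; ring.
Qed.

Lemma Cexp_0 : Cexp 0 = 1%C.
Proof. unfold Cexp; simpl; rewrite exp_0, cos_0, sin_0; unfold RtoC; f_equal; ring. Qed.

Lemma Dr_id x : Dr (fun t => RtoC t) x 1%C.
Proof. apply (Dr_real (fun t => t)); apply (@is_derive_id R_AbsRing). Qed.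

Lemma exp_le_Cmod w t : 0 <= t <= 1 -> exp (Re (RtoC t * w)%C) <= exp (Cmod w).
Proof.
intros Ht.
assert (H : Re (RtoC t * w)%C <= Cmod w).
{ rewrite re_scal_l.
  pose proof (re_le_Cmod w) as H; pose proof (Cmod_ge_0 w); apply Rabs_le_between in H; nra. }
destruct H as [H|H]; [left; apply exp_increasing; exact H | rewrite H; lra].
Qed.

Lemma Cexp_bound1 w : Cmod (Cexp w - 1) <= 2 * Cmod w * exp (Cmod w).
Proof.
pose proof (mvtC (fun t => Cexp (RtoC t * w)) (fun t => w * Cexp (RtoC t * w))%C 0 1
  (Cmod w * exp (Cmod w))) as H.
cbv beta in H; rewrite Cmult_1_l, Cmult_0_l, Cexp_0 in H.
eapply Rle_trans; [apply H|]; [lra| | |right; ring].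
- intros x _; eapply Dr_eq; [apply (Dr_Cexp (fun t => RtoC t * w)%C), Dr_mult; [apply Dr_id|apply Dr_const]|].
  cbv beta; ring.
- intros x Hx; rewrite Cmod_mult, Cmod_Cexp.
  apply Rmult_le_compat_l; [apply Cmod_ge_0 | apply exp_le_Cmod; lra].
Qed.

Lemma Cexp_bound2 w : Cmod (Cexp w - 1 - w) <= 4 * (Cmod w * Cmod w) * exp (Cmod w).
Proof.
pose proof (mvtC (fun t => Cexp (RtoC t * w) - RtoC t * w)%C (fun t => w * (Cexp (RtoC t * w) - 1))%C 0 1
  (2 * (Cmod w * Cmod w) * exp (Cmod w))) as H.
cbv beta in H; rewrite Cmult_1_l, Cmult_0_l, Cexp_0 in H.
replace (Cexp w - 1 - w)%C with (Cexp w - w - (1 - 0))%C by ring.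
eapply Rle_trans; [apply H|]; [lra| | |right; ring].
- intros x _; eapply Dr_eq.
  + apply Dr_minus; [apply (Dr_Cexp (fun t => RtoC t * w)%C)|]; (apply Dr_mult; [apply Dr_id|apply Dr_const]).
  + cbv beta; ring.
- intros x Hx; rewrite Cmod_mult.
  assert (E : Cmod (RtoC x * w) <= Cmod w).
  { rewrite Cmod_mult, Cmod_R, Rabs_pos_eq by lra. pose proof (Cmod_ge_0 w); nra. }
  pose proof (Cexp_bound1 (RtoC x * w)) as H1.
  assert (E2 : exp (Cmod (RtoC x * w)) <= exp (Cmod w)).
  { destruct E as [E|E]; [left; apply exp_increasing; exact E|rewrite E; lra]. }
  pose proof (Cmod_ge_0 w). pose proof (Cmod_ge_0 (RtoC x * w)).
  pose proof (exp_pos (Cmod (RtoC x * w))).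
  replace (2 * (Cmod w * Cmod w) * exp (Cmod w)) with (Cmod w * (2 * Cmod w * exp (Cmod w))) by ring.
  apply Rmult_le_compat_l; [lra|].
  eapply Rle_trans; [apply H1|].
  apply Rmult_le_compat; [lra| lra |lra|exact E2].
Qed.

Lemma kernel_bound (K dK G : R -> C) B m :
  (forall x, m <= x <= m + 1 -> Dr G x (- K x)%C) ->
  (forall x, m <= x <= m + 1 -> Dr K x (dK x)) ->
  (forall x, m <= x <= m + 1 -> Cmod (dK x) <= B) ->
  Cmod (K (m + 1)%R + (G (m + 1)%R - G m)) <= 4 * B.
Proof.
intros HG HK HB.
assert (B0 : 0 <= B). { eapply Rle_trans; [apply Cmod_ge_0 | apply (HB m); lra]. }
pose proof (mvtC (fun x => G x + RtoC x * K (m + 1)%R)%C (fun x => K (m + 1)%R - K x)%C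
  m (m + 1)%R (2 * B)) as H.
cbv beta in H.
replace (K (m + 1)%R + (G (m + 1)%R - G m))%C
  with (G (m + 1)%R + RtoC (m + 1)%R * K (m + 1)%R - (G m + RtoC m * K (m + 1)%R))%C
  by (rewrite RtoC_plus; ring).
eapply Rle_trans; [apply H|]; [lra| | |right; ring].
- intros x Hx; eapply Dr_eq.
  + apply Dr_plus; [apply HG; exact Hx|].
    apply Dr_mult; [apply Dr_id|apply Dr_const].
  + cbv beta; ring.
- intros x Hx.
  eapply Rle_trans; [apply (mvtC K dK x (m + 1)%R B); [lra| |]|].
  + intros y Hy; apply HK; lra.
  + intros y Hy; apply HB; lra.
  + nra.
Qed.

Lemma RtoC_neq_0 x : x <> 0 -> RtoC x <> 0%C.
Proof. intros H E; apply H, RtoC_inj, E. Qed.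

Lemma Dr_ln x : 0 < x -> Dr (fun y => RtoC (ln y)) x (/ RtoC x)%C.
Proof.
intros Hx; rewrite <- RtoC_inv by lra.
apply (Dr_real ln); apply is_derive_ln; exact Hx.
Qed.

Lemma Dr_rcpow s x : 0 < x -> Dr (fun y => rcpow y s) x (s / RtoC x * rcpow x s)%C.
Proof.
intros Hx; eapply Dr_eq.
- apply (Dr_Cexp (fun y => RtoC (ln y) * s)%C).
  apply Dr_mult; [apply Dr_ln; exact Hx|apply Dr_const].
- unfold rcpow; cbv beta; unfold Cdiv; ring.
Qed.

Lemma rcpow_1m s x : 0 < x -> rcpow x (1 - s) = (RtoC x * rcpow x (- s))%C.
Proof.
intros Hx; unfold rcpow.
replace (RtoC (ln x) * (1 - s))%C with (RtoC (ln x) + RtoC (ln x) * - s)%C by ring.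
rewrite Cexp_plus; f_equal.
unfold Cexp, RtoC; simpl; rewrite exp_ln, cos_0, sin_0 by exact Hx.
f_equal; ring.
Qed.

Lemma Cmod_rcpow s x : Cmod (rcpow x s) = exp (Re s * ln x).
Proof. unfold rcpow; rewrite Cmod_Cexp, re_scal_l; f_equal; ring. Qed.

Lemma sm1_neq_0 (s : C) : s <> 1%C -> (s - 1)%C <> 0%C.
Proof. intros H E; apply H, Ceq_minus, E. Qed.

Definition zt_g (s : C) (x : R) : C := (rcpow x (1 - s) / (s - 1))%C.

Definition zt_g' (s : C) (x : R) : C := (- (RtoC (ln x) * zt_g s x) - zt_g s x / (s - 1))%C.

Lemma Dr_g (s : C) x : s <> 1%C -> 0 < x -> Dr (zt_g s) x (- rcpow x (- s))%C.
Proof.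
intros Hs Hx; pose proof (sm1_neq_0 s Hs) as Hs1; pose proof (RtoC_neq_0 x ltac:(lra)) as Hx'.
eapply Dr_eq.
- apply Dr_mult; [apply Dr_rcpow; exact Hx | apply Dr_const].
- rewrite (rcpow_1m s x Hx); field; auto.
Qed.

Lemma Dr_g' (s : C) x : s <> 1%C -> 0 < x -> Dr (zt_g' s) x (RtoC (ln x) * rcpow x (- s))%C.
Proof.
intros Hs Hx; pose proof (sm1_neq_0 s Hs) as Hs'; pose proof (RtoC_neq_0 x ltac:(lra)) as Hx'.
eapply Dr_eq.
- apply Dr_minus; [apply Dr_opp, Dr_mult; [apply Dr_ln|apply Dr_g]|
   apply Dr_mult; [apply Dr_g|apply Dr_const]]; assumption.
- unfold zt_g; rewrite (rcpow_1m s x Hx); field; auto.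
Qed.

Definition zt_d (s : C) (n : nat) : C :=
  (rcpow (INR (S n) + 1)%R (- s) + (zt_g s (INR (S n) + 1)%R - zt_g s (INR (S n))))%C.

Definition zt_d' (s : C) (n : nat) : C :=
  (- (RtoC (ln (INR (S n) + 1)%R) * rcpow (INR (S n) + 1)%R (- s))
   + (zt_g' s (INR (S n) + 1)%R - zt_g' s (INR (S n))))%C.

Definition zt_p (a : R) (n : nat) : R := exp (- (1 + a) * ln (INR (S n))).

Lemma INR_S_ge1 n : 1 <= INR (S n).
Proof. rewrite S_INR; pose proof (pos_INR n); lra. Qed.

Lemma exp_le x y : x <= y -> exp x <= exp y.
Proof. intros [H|H]; [left; apply exp_increasing; exact H | rewrite H; lra]. Qed.

Lemma ln_le' x y : 0 < x -> x <= y -> ln x <= ln y.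
Proof. intros H [K|K]; [left; apply ln_increasing; lra | rewrite K; lra]. Qed.

Lemma ln_ge_0 x : 1 <= x -> 0 <= ln x.
Proof. intros H; rewrite <- ln_1; apply ln_le'; lra. Qed.

Lemma inv_exp_ln x : 0 < x -> / x = exp (- ln x).
Proof. intros H; rewrite exp_Ropp, exp_ln by exact H; reflexivity. Qed.

Lemma Cmod_invR x : 0 < x -> Cmod (/ RtoC x) = exp (- ln x).
Proof.
intros H; rewrite <- RtoC_inv, Cmod_R, <- inv_exp_ln by lra.
apply Rabs_pos_eq; left; apply Rinv_0_lt_compat, H.
Qed.

Lemma d_bound (s : C) n : 0 < Re s -> s <> 1%C -> Cmod (zt_d s n) <= 4 * Cmod s * zt_p (Re s) n.
Proof.
intros Hs Hs1; pose proof (INR_S_ge1 n) as Hm; unfold zt_d, zt_p.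
set (m := INR (S n)) in *.
rewrite Rmult_assoc.
apply (kernel_bound (fun x => rcpow x (- s)) (fun x => - s / RtoC x * rcpow x (- s))%C).
- intros x Hx; apply Dr_g; [exact Hs1|lra].
- intros x Hx; apply Dr_rcpow; lra.
- intros x Hx; unfold Cdiv.
  rewrite !Cmod_mult, Cmod_opp, Cmod_invR, Cmod_rcpow, Rmult_assoc, <- exp_plus by lra.
  apply Rmult_le_compat_l; [apply Cmod_ge_0|].
  apply exp_le; rewrite re_opp.
  pose proof (ln_le' m x ltac:(lra) ltac:(lra)); nra.
Qed.

Lemma le_exp_div a x : 0 < a -> x <= exp (a * x) / a.
Proof.
intros Ha; pose proof (exp_ineq1_le (a * x)).
apply Rmult_le_reg_l with a; [exact Ha|].
replace (a * (exp (a * x) / a)) with (exp (a * x)) by (field; lra); lra.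
Qed.

Definition zt_c (s : C) (a : R) : R := 4 * (4 * Cmod s / (a * a) + 2 / a).

Lemma d_quad (s h : C) a n : 0 < a -> Re s = 4 * a -> Cmod h <= a -> s <> 1%C -> (s + h)%C <> 1%C ->
  Cmod (zt_d (s + h) n - zt_d s n - h * zt_d' s n) <= zt_c s a * (Cmod h * Cmod h) * zt_p a n.
Proof.
intros Ha Hs Hh Hs1 Hs2; pose proof (INR_S_ge1 n) as Hm; unfold zt_d, zt_d', zt_p, zt_c.
set (m := INR (S n)) in *.
set (E := fun x => Cexp (- (h * RtoC (ln x)))%C).
set (K := fun x => (rcpow x (- (s + h)) - rcpow x (- s) + h * (RtoC (ln x) * rcpow x (- s)))%C).
set (G := fun x => (zt_g (s + h) x - zt_g s x - h * zt_g' s x)%C).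
assert (EE : forall x, rcpow x (- (s + h)) = (rcpow x (- s) * E x)%C).
{ intros x; unfold rcpow, E; rewrite <- Cexp_plus; f_equal; ring. }
match goal with |- Cmod ?X <= _ => replace X with (K (m + 1)%R + (G (m + 1)%R - G m))%C
 by (unfold K, G; ring) end.
rewrite !Rmult_assoc.
apply (kernel_bound K (fun x => / RtoC x * (rcpow x (- s) *
  (- s * (E x - 1 - - (h * RtoC (ln x))) - h * (E x - 1))))%C).
- intros x Hx; eapply Dr_eq.
  + apply Dr_minus; [apply Dr_minus; apply Dr_g; [exact Hs2|lra|exact Hs1|lra]|].
    apply Dr_scal, Dr_g'; [exact Hs1|lra].
  + unfold K; ring.
- intros x Hx.
  pose proof (RtoC_neq_0 x ltac:(lra)) as Hx'.
  eapply Dr_eq.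
  + apply Dr_plus; [apply Dr_minus; apply Dr_rcpow; lra|].
    apply Dr_scal, Dr_mult; [apply Dr_ln; lra|apply Dr_rcpow; lra].
  + rewrite EE; field; exact Hx'.
- intros x Hx.
  rewrite !Cmod_mult, Cmod_invR, Cmod_rcpow, re_opp, Hs by lra.
  pose proof (ln_ge_0 x ltac:(lra)) as HL.
  pose proof (ln_le' m x ltac:(lra) ltac:(lra)) as HLm.
  set (w := (- (h * RtoC (ln x)))%C).
  assert (Hw : Cmod w = Cmod h * ln x).
  { unfold w; rewrite Cmod_opp, Cmod_mult, Cmod_R, Rabs_pos_eq; lra. }
  pose proof (Cexp_bound1 w) as B1; pose proof (Cexp_bound2 w) as B2.
  change (Cexp w) with (E x) in B1, B2; rewrite Hw in B1, B2.
  set (L := ln x) in *; set (c := Cmod h) in *.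
  pose proof (Cmod_ge_0 h : 0 <= c) as Hc.
  pose proof (Cmod_ge_0 s) as Hs0.
  set (y := exp (a * L)).
  assert (Hy : 1 <= y). { pose proof (exp_ineq1_le (a * L)); unfold y; nra. }
  assert (Hyc : exp (c * L) <= y). { apply exp_le; nra. }
  assert (HyL : L <= y / a). { apply le_exp_div; exact Ha. }
  assert (HT : Cmod (- s * (E x - 1 - w) - h * (E x - 1)) <=
     (4 * Cmod s / (a * a) + 2 / a) * (c * c) * (y * y * y)).
  { eapply Rle_trans; [apply Cmod_minus_le|].
    rewrite !Cmod_mult, Cmod_opp; fold c.
    assert (Ia : 0 < / a) by (apply Rinv_0_lt_compat, Ha).
    assert (HLL : L * L <= (y / a) * (y / a)) by (apply Rmult_le_compat; lra).
    pose proof (exp_pos (c * L)) as Hp.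
    assert (Q2 : L * L * exp (c * L) <= (y / a) * (y / a) * y).
    { apply Rmult_le_compat; [nra|lra|exact HLL|exact Hyc]. }
    assert (Q1 : L * exp (c * L) <= (y / a) * y).
    { apply Rmult_le_compat; [lra|lra|exact HyL|exact Hyc]. }
    assert (Q1' : (y / a) * y <= / a * (y * y * y)).
    { unfold Rdiv; replace (y * / a * y) with (/ a * (y * y)) by ring.
      apply Rmult_le_compat_l; [lra|]; nra. }
    apply Rle_trans with (Cmod s * (4 * (c * c) * ((y / a) * (y / a) * y))
      + c * (2 * c * (/ a * (y * y * y)))).
    - apply Rplus_le_compat.
      + apply Rmult_le_compat_l; [exact Hs0|].
        eapply Rle_trans; [apply B2|].
        replace (4 * (c * L * (c * L)) * exp (c * L)) with (4 * (c * c) * (L * L * exp (c * L))) by ring.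
        apply Rmult_le_compat_l; [nra|exact Q2].
      + apply Rmult_le_compat_l; [exact Hc|].
        eapply Rle_trans; [apply B1|].
        replace (2 * (c * L) * exp (c * L)) with (2 * c * (L * exp (c * L))) by ring.
        apply Rmult_le_compat_l; [lra|lra].
    - right; field; lra. }
  apply Rle_trans with (exp (- L) * (exp (- (4 * a) * L) *
    ((4 * Cmod s / (a * a) + 2 / a) * (c * c) * (y * y * y)))).
  + apply Rmult_le_compat_l; [left; apply exp_pos|].
    apply Rmult_le_compat_l; [left; apply exp_pos|exact HT].
  + replace (y * y * y) with (exp (3 * a * L)).
    2: { unfold y; rewrite <- !exp_plus; f_equal; ring. }
    replace (exp (- L) * _) with ((4 * Cmod s / (a * a) + 2 / a) * (c * (c * exp (- (1 + a) * L)))).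
    2: { replace (- (1 + a) * L) with (- L + (- (4 * a) * L + 3 * a * L)) by ring.
         rewrite !exp_plus; ring. }
    apply Rmult_le_compat_l.
    { assert (Ia : 0 < / a) by (apply Rinv_0_lt_compat, Ha).
      assert (Iaa : 0 < / (a * a)) by (apply Rinv_0_lt_compat; nra).
      unfold Rdiv; nra. }
    do 2 (apply Rmult_le_compat_l; [exact Hc|]).
    apply exp_le; nra.
Qed.

Lemma is_series_telescope {K : AbsRing} {V : NormedModule K} (u : nat -> V) :
  filterlim u eventually (locally (@zero V)) ->
  is_series (fun n => minus (u n) (u (S n))) (u O).
Proof.
intros H; unfold is_series.
apply (filterlim_ext (fun n => minus (u O) (u (S n)))).
- intros n; induction n as [|n IH].
  + rewrite sum_O; reflexivity.
  + rewrite sum_Sn, <- IH; exact (@minus_trans (NormedModule.AbelianGroup K V) _ _ _).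
- replace (locally (u O)) with (locally (minus (u O) (@zero V))).
  2: { f_equal; exact (@minus_zero_r (NormedModule.AbelianGroup K V) _). }
  apply (filterlim_comp_2 (G := locally (u O)) (H := locally (opp (@zero V))) (fun _ => u O) (fun n => opp (u (S n))) plus); [apply filterlim_const | | apply (filterlim_plus (u O) (opp zero))].
  apply (filterlim_comp _ _ _ (fun n => u (S n)) opp _ (locally (@zero V))); [|apply filterlim_opp].
  apply (filterlim_comp _ _ _ S u _ eventually); [|exact H].
  intros P [N HN]; exists N; intros n Hn; apply HN; lia.
Qed.

Lemma exp_ln_lim a : 0 < a -> is_lim_seq (fun n => exp (- a * ln (INR (S n)))) 0.
Proof.
intros Ha.
assert (H1 : is_lim_seq (fun n => ln (INR (S n))) p_infty).
{ assert (H0 : is_lim_seq (fun n => INR (S n)) p_infty).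
  { apply (is_lim_seq_incr_1 INR), is_lim_seq_INR. }
  eapply filterlim_comp; [exact H0|apply is_lim_ln_p]. }
assert (H2 : is_lim_seq (fun n => - a * ln (INR (S n))) m_infty).
{ replace m_infty with (Rbar_mult (- a) p_infty).
  - apply is_lim_seq_scal_l, H1.
  - simpl; destruct (Rle_dec 0 (- a)); [exfalso; lra|reflexivity]. }
eapply filterlim_comp; [apply H2|apply is_lim_exp_m].
Qed.

Lemma p_summable a : 0 < a -> ex_series (zt_p a).
Proof.
intros Ha; apply ex_series_incr_1.
set (e := fun n => exp (- a * ln (INR (S n)))).
assert (He : ex_series (fun n => scal (/ a) (minus (e n) (e (S n))))).
{ apply (ex_series_scal (K := R_AbsRing) (V := R_NormedModule)).
  eexists; apply (is_series_telescope (K := R_AbsRing) (V := R_NormedModule) e).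
  apply (exp_ln_lim a Ha). }
refine (@ex_series_le R_AbsRing R_CompleteNormedModule _ _ _ He).
intros n; unfold zt_p.
change (Rabs (exp (- (1 + a) * ln (INR (S (S n))))) <= / a * (e n - e (S n))).
rewrite Rabs_pos_eq by (left; apply exp_pos).
unfold e; rewrite (S_INR (S n)); pose proof (INR_S_ge1 n) as Hm.
set (m := INR (S n)) in *.
set (u := ln m); set (v := ln (m + 1)).
assert (Hu : exp u = m) by (apply exp_ln; lra).
assert (Hv : exp v = m + 1) by (apply exp_ln; lra).
assert (H1 : exp (- v) <= v - u).
{ pose proof (exp_ineq1_le (u + - v)) as Q.
  rewrite exp_plus, Hu in Q.
  assert (Q2 : exp (- v) * (m + 1) = 1) by (rewrite <- Hv, <- exp_plus, Rplus_opp_l; apply exp_0).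
  nra. }
pose proof (exp_ineq1_le (a * (v - u))) as Q.
replace (- a * u) with (- a * v + a * (v - u)) by ring.
replace (- (1 + a) * v) with (- a * v + - v) by ring.
rewrite !exp_plus; pose proof (exp_pos (- a * v)) as Hp.
apply Rmult_le_reg_l with a; [exact Ha|].
replace (a * (/ a * (exp (- a * v) * exp (a * (v - u)) - exp (- a * v))))
  with (exp (- a * v) * (exp (a * (v - u)) - 1)) by (field; lra).
replace (a * (exp (- a * v) * exp (- v))) with (exp (- a * v) * (a * exp (- v))) by ring.
apply Rmult_le_compat_l; nra.
Qed.

Lemma C_series_bound (u : nat -> C) (l : C) (b : nat -> R) (lb : R) :
  @is_series C_AbsRing C_NormedModule u l -> is_series b lb ->
  (forall n, Cmod (u n) <= b n) -> Cmod l <= lb.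
Proof.
intros Hu Hb H.
refine (is_lim_seq_le (fun N => Cmod (@sum_n C_AbelianGroup u N)) (sum_n b) (Cmod l) lb _ _ Hb).
- intros N; induction N as [|N IH]; rewrite ?sum_O, ?sum_Sn.
  + apply H.
  + eapply Rle_trans; [apply Cmod_triangle|].
    apply Rplus_le_compat; [exact IH|apply H].
- eapply filterlim_comp; [exact Hu|].
  apply (@filterlim_norm C_AbsRing C_NormedModule).
Qed.

Lemma zeta_approx_S N (s : C) :
  s <> 1%C -> zeta_approx (S N) s = (zeta_approx 0 s + @sum_n C_AbelianGroup (zt_d s) N)%C.
Proof.
intros Hs.
assert (E : forall n, zeta_approx (S n) s = (zeta_approx n s + zt_d s n)%C).
{ intros n; unfold zeta_approx, zt_d, zt_g; rewrite sum_Sn, !(S_INR (S n)).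
  change (@plus C_AbelianMonoid) with Cplus; change (@plus C_AbelianGroup) with Cplus. ring. }
induction N as [|N IH].
- rewrite E, sum_O; reflexivity.
- rewrite E, IH, sum_Sn; change (@plus C_AbelianGroup) with Cplus; ring.
Qed.

Lemma zeta_series s : 0 < Re s -> s <> 1%C ->
  @is_series C_AbsRing C_NormedModule (zt_d s) (zeta s - zeta_approx 0 s)%C.
Proof.
intros Hs Hs1.
assert (Hex : @ex_series C_AbsRing C_NormedModule (zt_d s)).
{ apply (@ex_series_le C_AbsRing C_CompleteNormedModule _ (fun n => scal (4 * Cmod s) (zt_p (Re s) n))).
  - intros n; apply d_bound; assumption.
  - apply (ex_series_scal (K := R_AbsRing) (V := R_NormedModule)), p_summable, Hs. }
destruct Hex as [l Hl].
assert (L1 : is_lim_seq (fun N => Re (zeta_approx N s)) (Re (zeta_approx 0 s) + Re l)).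
{ apply is_lim_seq_incr_1.
  apply (is_lim_seq_ext (fun N => Re (zeta_approx 0 s) + Re (@sum_n C_AbelianGroup (zt_d s) N))).
  { intros N; rewrite (zeta_approx_S N s Hs1); symmetry; apply re_plus. }
  apply is_lim_seq_plus'; [apply is_lim_seq_const|].
  eapply filterlim_comp; [exact Hl|].
  destruct l as [x y]; apply (@continuous_fst R_UniformSpace R_UniformSpace). }
assert (L2 : is_lim_seq (fun N => Im (zeta_approx N s)) (Im (zeta_approx 0 s) + Im l)).
{ apply is_lim_seq_incr_1.
  apply (is_lim_seq_ext (fun N => Im (zeta_approx 0 s) + Im (@sum_n C_AbelianGroup (zt_d s) N))).
  { intros N; rewrite (zeta_approx_S N s Hs1); symmetry; apply im_plus. }
  apply is_lim_seq_plus'; [apply is_lim_seq_const|].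
  eapply filterlim_comp; [exact Hl|].
  destruct l as [x y]; apply (@continuous_snd R_UniformSpace R_UniformSpace). }
replace (zeta s - zeta_approx 0 s)%C with l; [exact Hl|].
unfold zeta.
rewrite (is_lim_seq_unique _ _ L1), (is_lim_seq_unique _ _ L2).
destruct l as [x y]; destruct (zeta_approx 0 s) as [x' y'].
unfold Cminus, Cplus, Copp; simpl; f_equal; ring.
Qed.

Lemma zeta_approx_0 s : zeta_approx 0 s = (1 + / (s - 1))%C.
Proof.
assert (E : forall z, rcpow 1 z = 1%C).
{ intros z; unfold rcpow; rewrite ln_1, Cmult_0_l; apply Cexp_0. }
unfold zeta_approx; rewrite sum_O; change (INR 1) with 1; rewrite !E.
unfold Cdiv; ring.
Qed.

Lemma zeta_Dirichlet s : 1 < Re s ->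
  @is_series C_AbsRing C_NormedModule (fun n => rcpow (INR (S n)) (- s)) (zeta s).
Proof.
intros Hs.
assert (Hs1 : s <> 1%C). { intros E; rewrite E in Hs; simpl in Hs; lra. }
set (u := fun n => zt_g s (INR (S n))).
assert (Hu : filterlim u eventually (locally (@zero C_NormedModule))).
{ apply (@filterlim_norm_zero _ C_AbsRing C_NormedModule eventually _).
  change (is_lim_seq (fun n => Cmod (u n)) 0).
  apply (is_lim_seq_ext (fun n => exp (- (Re s - 1) * ln (INR (S n))) * Cmod (/ (s - 1)))).
  - intros n; unfold u, zt_g, Cdiv.
    change (exp (- (Re s - 1) * ln (INR (S n))) * Cmod (/ (s - 1)) = Cmod (rcpow (INR (S n)) (1 - s) * / (s - 1))).
    rewrite Cmod_mult, Cmod_rcpow; f_equal; f_equal.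
    unfold Cminus; rewrite re_plus, re_opp; simpl; ring.
  - replace 0 with (0 * Cmod (/ (s - 1))) by ring.
    apply is_lim_seq_mult'; [apply exp_ln_lim; lra|apply is_lim_seq_const]. }
pose proof (is_series_telescope u Hu) as T.
pose proof (is_series_plus _ _ _ _ (zeta_series s ltac:(lra) Hs1) T) as Q.
apply (@is_series_decr_1 C_AbsRing C_NormedModule (fun n => rcpow (INR (S n)) (- s))%C).
refine (eq_rect _ (fun z => @is_series C_AbsRing C_NormedModule _ z) _ _ _).
- eapply is_series_ext; [|exact Q].
  intros n; unfold zt_d, u; rewrite (S_INR (S n)).
  change (rcpow (INR (S n) + 1)%R (- s) + (zt_g s (INR (S n) + 1)%R - zt_g s (INR (S n)))
    + (zt_g s (INR (S n)) - zt_g s (INR (S n) + 1)%R) = rcpow (INR (S n) + 1)%R (- s))%C.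
  ring.
- unfold u; rewrite zeta_approx_0.
  change (zeta s - (1 + / (s - 1)) + rcpow (INR 1) (1 - s) / (s - 1) = zeta s - rcpow (INR 1) (- s))%C.
  assert (E : forall z, rcpow (INR 1) z = 1%C).
  { intros z; unfold rcpow; simpl; rewrite ln_1, Cmult_0_l; apply Cexp_0. }
  rewrite !E; unfold Cdiv; ring.
Qed.

Lemma quadratic_derive (f : C -> C) (s l : C) (M r : R) : 0 < r ->
  (forall h, Cmod h <= r -> Cmod (f (s + h)%C - f s - h * l)%C <= M * (Cmod h * Cmod h)) ->
  @is_derive C_AbsRing C_NormedModule f s l.
Proof.
intros Hr H; split.
{ apply (@is_linear_scal_l C_AbsRing C_NormedModule). }
intros z Hz.
assert (E : z = s).
{ symmetry; apply (@is_filter_lim_locally_unique C_AbsRing (AbsRing_NormedModule C_AbsRing)); exact Hz. }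
subst z; intros eps.
assert (HM : 0 < Rabs M + 1) by (pose proof (Rabs_pos M); lra).
assert (Hd : 0 < Rmin r (eps / (Rabs M + 1))).
{ apply Rmin_glb_lt; [exact Hr|apply Rdiv_lt_0_compat; [apply cond_pos|exact HM]]. }
exists (mkposreal _ Hd); intros y Hy.
change (Cmod (y - s) < Rmin r (eps / (Rabs M + 1))) in Hy.
change (Cmod (f y - f s - (y - s) * l) <= eps * Cmod (y - s)).
specialize (H (y - s)%C).
assert (Ey : forall y0 : C, (s + (y0 - s))%C = y0) by (intros; ring).
rewrite Ey in H; clear Ey.
pose proof (Rmin_l r (eps / (Rabs M + 1))); pose proof (Rmin_r r (eps / (Rabs M + 1))).
set (c := Cmod (y - s)) in *.
pose proof (Cmod_ge_0 (y - s) : 0 <= c) as Hc.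
eapply Rle_trans; [apply H; lra|].
rewrite <- Rmult_assoc; apply Rmult_le_compat_r; [exact Hc|].
pose proof (Rle_abs M).
apply Rle_trans with ((Rabs M + 1) * c); [nra|].
apply Rle_trans with ((Rabs M + 1) * (eps / (Rabs M + 1))); [|right; field; lra].
apply Rmult_le_compat_l; lra.
Qed.

Lemma zeta_ex_derive (s : C) : 0 < Re s -> s <> 1%C ->
  @ex_derive C_AbsRing C_NormedModule zeta s.
Proof.
intros Hs Hs1.
set (w := (s - 1)%C).
assert (Hw : w <> 0%C) by (apply sm1_neq_0, Hs1).
assert (Hw' : 0 < Cmod w) by (apply Cmod_gt_0, Hw).
set (a := Re s / 4).
assert (Ha : 0 < a) by (unfold a; lra).
assert (Hsa : Re s = 4 * a) by (unfold a; lra).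
set (r := Rmin a (Cmod w / 2)).
assert (Hr : 0 < r) by (apply Rmin_glb_lt; lra).
assert (Hra : r <= a) by apply Rmin_l.
assert (Hrw : r <= Cmod w / 2) by apply Rmin_r.
assert (Hwh : forall h, Cmod h <= r -> Cmod w / 2 <= Cmod (w + h)).
{ intros h Hh.
  pose proof (Cmod_minus_le (w + h) h) as Q.
  replace (w + h - h)%C with w in Q by ring; lra. }
assert (Hwh0 : forall h, Cmod h <= r -> (w + h)%C <> 0%C).
{ intros h Hh; apply Cmod_gt_0; specialize (Hwh h Hh); lra. }
assert (Hsh1 : forall h, Cmod h <= r -> (s + h)%C <> 1%C).
{ intros h Hh E; apply (Hwh0 h Hh); unfold w.
  replace (s - 1 + h)%C with (s + h - 1)%C by ring; rewrite E; ring. }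
assert (Hsh : forall h, Cmod h <= r -> 0 < Re (s + h)%C).
{ intros h Hh; rewrite re_plus.
  pose proof (re_le_Cmod h) as Q; apply Rabs_le_between in Q; lra. }
destruct (p_summable a Ha) as [P HP].
set (c := zt_c s a) in *.
set (B := fun h n => c * (Cmod h * Cmod h) * zt_p a n).
set (Rm := fun h n => (zt_d (s + h) n - zt_d s n - h * zt_d' s n)%C).
assert (HRm : forall h, Cmod h <= r -> forall n, Cmod (Rm h n) <= B h n).
{ intros h Hh n; apply d_quad; try assumption; [lra|apply Hsh1, Hh]. }
assert (HB : forall h, is_series (B h) (c * (Cmod h * Cmod h) * P)).
{ intros h; apply (is_series_scal (K := R_AbsRing) (V := R_NormedModule) _ _ _ HP). }
assert (HD : forall h, Cmod h <= r -> @is_series C_AbsRing C_NormedModule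
   (fun n => zt_d (s + h) n - zt_d s n)%C
   (zeta (s + h) - zeta_approx 0 (s + h) - (zeta s - zeta_approx 0 s))%C).
{ intros h Hh.
  apply (is_series_minus (K := C_AbsRing) (V := C_NormedModule)).
  - apply zeta_series; [apply Hsh, Hh|apply Hsh1, Hh].
  - apply zeta_series; assumption. }
assert (Hr0 : Cmod (RtoC r) <= r) by (rewrite Cmod_R, Rabs_pos_eq; lra).
assert (HE : exists D, @is_series C_AbsRing C_NormedModule (zt_d' s) D).
{ assert (HX : @ex_series C_AbsRing C_NormedModule (Rm (RtoC r))).
  { apply (@ex_series_le C_AbsRing C_CompleteNormedModule _ (B (RtoC r))).
    - intros n; apply HRm, Hr0.
    - eexists; apply HB. }
  destruct HX as [X HX].
  eexists.
  eapply is_series_ext; [|apply (is_series_scal (K := C_AbsRing) (V := C_NormedModule) (/ RtoC r)%C),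
    (is_series_minus (K := C_AbsRing) (V := C_NormedModule) _ _ _ _ (HD _ Hr0) HX)].
  intros n; unfold Rm.
  change (/ RtoC r * (zt_d (s + RtoC r) n - zt_d s n - (zt_d (s + RtoC r) n - zt_d s n - RtoC r * zt_d' s n))
    = zt_d' s n)%C.
  field; apply RtoC_neq_0; lra. }
destruct HE as [D HDD].
exists (D - / (w * w))%C.
apply (quadratic_derive _ _ _ (c * P + 2 / (Cmod w * Cmod w * Cmod w)) r Hr).
intros h Hh.
assert (HRs : @is_series C_AbsRing C_NormedModule (Rm h)
   (zeta (s + h) - zeta_approx 0 (s + h) - (zeta s - zeta_approx 0 s) - h * D)%C).
{ apply (is_series_minus (K := C_AbsRing) (V := C_NormedModule) _ _ _ _ (HD _ Hh)).
  apply (is_series_scal (K := C_AbsRing) (V := C_NormedModule)), HDD. }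
pose proof (C_series_bound _ _ _ _ HRs (HB h) (HRm h Hh)) as Q.
set (X := (zeta (s + h) - zeta_approx 0 (s + h) - (zeta s - zeta_approx 0 s) - h * D)%C) in *.
replace (zeta (s + h) - zeta s - h * (D - / (w * w)))%C
  with (X + h * h * / (w * w * (w + h)))%C.
2: { unfold X; rewrite !zeta_approx_0; fold w.
     replace (s + h - 1)%C with (w + h)%C by (unfold w; ring).
     field; pose proof (Hwh0 h Hh); auto. }
eapply Rle_trans; [apply Cmod_triangle|].
rewrite Rmult_plus_distr_r; apply Rplus_le_compat.
- eapply Rle_trans; [apply Q|right; ring].
- pose proof (Hwh0 h Hh) as Hn; pose proof (Hwh h Hh) as Hn'.
  rewrite !Cmod_mult, Cmod_inv, !Cmod_mult by auto using Cmult_neq_0.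
  rewrite (Rmult_comm _ (Cmod h * Cmod h)).
  apply Rmult_le_compat_l; [pose proof (Cmod_ge_0 h); nra|].
  replace (2 / (Cmod w * Cmod w * Cmod w)) with (/ (Cmod w * Cmod w * (Cmod w / 2))) by (field; lra).
  apply Rinv_le_contravar; [apply Rmult_lt_0_compat; nra|].
  apply Rmult_le_compat_l; nra.
Qed.

Theorem zeta_is_continuation : is_Dirichlet_continuation zeta.
Proof. split; [exact zeta_Dirichlet | exact zeta_ex_derive]. Qed.

Lemma ln_succ_bounds m : 0 < m -> / (m + 1) <= ln (m + 1) - ln m <= / m.
Proof.
intros Hm.
pose proof (exp_ln m Hm) as Hu; pose proof (exp_ln (m + 1) ltac:(lra)) as Hv.
set (u := ln m) in *; set (v := ln (m + 1)) in *.
pose proof (exp_ineq1_le (u + - v)) as Q1; pose proof (exp_ineq1_le (v + - u)) as Q2.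
rewrite exp_plus, exp_Ropp, Hu, Hv in Q1; rewrite exp_plus, exp_Ropp, Hu, Hv in Q2.
replace (m * / (m + 1)) with (1 - / (m + 1)) in Q1 by (field; lra).
replace ((m + 1) * / m) with (1 + / m) in Q2 by (field; lra).
lra.
Qed.

Lemma is_lim_euler_gamma :
  is_lim_seq (fun n => sum_n (fun k => / INR (S k)) n - ln (INR (S n))) euler_gamma.
Proof.
apply Lim_seq_correct'.
apply (ex_finite_lim_seq_decr _ 0); intros n.
- rewrite sum_Sn; change (@plus R_AbelianMonoid) with Rplus.
  rewrite (S_INR (S n)); pose proof (INR_S_ge1 n) as Hm.
  pose proof (ln_succ_bounds (INR (S n)) ltac:(lra)); lra.
- assert (H : ln (INR (S n) + 1) <= sum_n (fun k => / INR (S k)) n).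
  { induction n as [|n IH].
    - rewrite sum_O; change (INR 1) with 1.
      pose proof (ln_succ_bounds 1 ltac:(lra)) as Q; rewrite ln_1 in Q; lra.
    - rewrite sum_Sn; change (@plus R_AbelianMonoid) with Rplus.
      rewrite (S_INR (S n)); pose proof (INR_S_ge1 n) as Hm.
      pose proof (ln_succ_bounds (INR (S n) + 1) ltac:(lra)); lra. }
  pose proof (INR_S_ge1 n) as Hm.
  pose proof (ln_le' (INR (S n)) (INR (S n) + 1) ltac:(lra) ltac:(lra)); lra.
Qed.

(* Main.v *)
Require Import Defs.
From Stdlib Require Import Reals Lra Lia List.
From Coquelicot Require Import Coquelicot.
Open Scope R_scope.

(** The proof uses the resonance method, with a resonator that needs no prime numbers.

    For [T <= t <= 2T] and [N] about [T ^ 4], the [l]-th derivative of zeta at [1 + it] is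
    [(-1)^l sum_(n <= N) (ln n)^l n^(-1-it)] up to [O (6 ^ l)] ([logsum_le_derive]).  This
    comes from differentiating the Euler-Maclaurin expansion term by term
    ([zeta_derive_n_series]); the remainder is small because [l <= ln T / ln ln T] means
    [(ln T) ^ l <= T].

    The weights [(ln n)^l / n] are nonnegative, so it suffices to find [t] with [n ^ (it)]
    close to [1] for all [n <= y].  Put [R(t) = sum_(m in B) m ^ (it)] and average
    [|R(t)|^2 Re (sum_n (ln n)^l n^(-1-it))] over [[T, 2T]] with a weight obtained by
    averaging over short intervals 13 times.  If [B] lies in [[1, T ^ (1/4)]], the
    frequencies [ln (n m / m')] are either zero or so large that the average kills them
    ([cos_sum_positive]); what remains is the sum of [(ln n)^l / n] times the number of
    solutions of [n m = m'] in [B].  By positivity the [n > y] may be discarded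
    ([resonance]).

    So one needs a set [B] of integers, most of which stay in [B] after multiplication by
    any [n <= y].  Let [B_j] be the set of products of [j] integers of [[1, y]].
    Multiplication by [n <= y] maps [B_j] into [B_(j+1)], and [B_(j+1)] cannot be much
    larger than [B_j] for all [j < K y], because the number of multisets of size [K y] in
    a set of [y] elements grows only like [exp (o(K) y)] as [K] increases
    ([prod_set_almost_invariant]).  The elements of [B_(j+1)] are at most
    [y ^ (K y)], which is below [T ^ (1/4)] for [y] a small multiple of [ln T / ln ln T].
    This is where [ln ln T - ln ln ln T + O(1) = ln y] comes from.

    The maximum is therefore at least nearly [sum_(n <= y) (ln n)^l / n], and this sum is
    nearly [(ln y)^(l+1) / (l+1)] ([log_weight_sum_ge]).  The constant of the theorem is
    smaller by a fixed factor: [l^l / (l+1)^(l+1) <= 1 / (2 (l+1))], and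
    [exp euler_gamma < 1.97 < 2] ([target_constant_le]).  The fixed factor absorbs every
    loss, and [E] can be taken constant. *)

(** * Derivatives of x^(-s) and of its primitive in x *)

Lemma Dr_ext (F G : R -> C) (x : R) (l : C) : (forall y, F y = G y) -> Dr F x l -> Dr G x l.
Proof.
intros E [H1 H2]; split.
- apply (is_derive_ext (fun y => Re (F y))); [intros t; rewrite E; reflexivity|exact H1].
- apply (is_derive_ext (fun y => Im (F y))); [intros t; rewrite E; reflexivity|exact H2].
Qed.

Lemma Dr_inv (F : R -> C) (x : R) (l : C) : F x <> 0%C -> Dr F x l -> Dr (fun y => / F y)%C x (- l / (F x * F x))%C.
Proof.
intros H0 [H1 H2].
assert (Hn : Re (F x) * Re (F x) + Im (F x) * Im (F x) <> 0).
{ intros E; apply H0; destruct (F x) as [a b]; unfold Re, Im in E; simpl in E.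
  unfold RtoC; f_equal; nra. }
set (N := fun y => Re (F y) * Re (F y) + Im (F y) * Im (F y)).
assert (HN : is_derive N x (Re l * Re (F x) + Re (F x) * Re l + (Im l * Im (F x) + Im (F x) * Im l))).
{ apply (@is_derive_plus R_AbsRing R_NormedModule); apply is_derive_mult_R; assumption. }
split.
- apply (is_derive_ext (fun y => Re (F y) / N y)).
  { intros t; unfold N, Re, Im, Cinv; destruct (F t) as [a b]; simpl; f_equal; f_equal; ring. }
  eapply is_derive_eq_R; [apply is_derive_div; [exact H1|exact HN|exact Hn]|].
  unfold N; revert Hn; destruct (F x) as [a b], l as [c d]; unfold Re, Im, Cdiv, Cinv, Cmult, Copp; simpl; intros Hn.
  field; repeat split; try nra; try (intros E; apply Hn; nra).
- apply (is_derive_ext (fun y => - Im (F y) / N y)).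
  { intros t; unfold N, Re, Im, Cinv; destruct (F t) as [a b]; simpl; f_equal; f_equal; ring. }
  eapply is_derive_eq_R; [apply is_derive_div;
    [apply (is_derive_opp (fun y => Im (F y))); exact H2|exact HN|exact Hn]|].
  change (opp (Im l)) with (- Im l).
  unfold N; revert Hn; destruct (F x) as [a b], l as [c d]; unfold Re, Im, Cdiv, Cinv, Cmult, Copp; simpl; intros Hn.
  field; repeat split; try nra; try (intros E; apply Hn; nra).
Qed.

(** The [k]-th derivative of [x ^ (- s)] with respect to [s]. *)
Definition dpow (k : nat) (s : C) (x : R) : C := (RtoC ((- ln x) ^ k) * rcpow x (- s))%C.

(** The [k]-th [s]-derivative of [x ^ (1 - s) / (s - 1)], written through the recurrence
    obtained by differentiating [k] times the identity [(s - 1) * g = x ^ (1 - s)].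
    Since [dpow k (s - 1) x] is the [k]-th derivative of [x ^ (1 - s)], no binomial sum
    appears, and bounds follow by induction on [k]. *)
Fixpoint dprim (k : nat) (s : C) (x : R) : C :=
  match k with
  | O => (dpow 0 (s - 1) x / (s - 1))%C
  | S j => ((dpow (S j) (s - 1) x - RtoC (INR (S j)) * dprim j s x) / (s - 1))%C
  end.

Lemma Dr_dpow_s k x F u l : Dr F u l -> Dr (fun y => dpow k (F y) x) u (l * dpow (S k) (F u) x)%C.
Proof.
intros H; unfold dpow, rcpow; eapply Dr_eq.
- apply Dr_scal, (Dr_Cexp (fun y => RtoC (ln x) * - F y)%C), Dr_scal, Dr_opp, H.
- cbv beta; rewrite <- tech_pow_Rmult, RtoC_mult, RtoC_opp; ring.
Qed.

(** Differentiating the recurrence for [dprim k] reproduces the one for [dprim (S k)]: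
    the extra [dprim k / (s - 1)] coming from [1 / (s - 1)] turns the factor [k] into
    [k + 1]. *)
Lemma Dr_dprim_s k x F u l : Dr F u l -> F u <> 1%C ->
  Dr (fun y => dprim k (F y) x) u (l * dprim (S k) (F u) x)%C.
Proof.
intros H H1; pose proof (sm1_neq_0 _ H1) as H1'.
assert (HF : Dr (fun y => F y - 1)%C u l).
{ eapply Dr_eq; [apply Dr_minus; [exact H|apply Dr_const]|ring]. }
assert (HI : Dr (fun y => / (F y - 1))%C u (- l / ((F u - 1) * (F u - 1)))%C).
{ apply (Dr_inv (fun y => F y - 1)%C); assumption. }
induction k as [|k IH].
- cbn [dprim]; unfold Cdiv at 1; eapply Dr_eq.
  + apply Dr_mult; [apply Dr_dpow_s, HF|exact HI].
  + cbn [dprim]; change (RtoC (INR 1)) with (RtoC 1); field; exact H1'.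
- eapply Dr_ext; [intros y; cbn [dprim]; unfold Cdiv at 1; reflexivity|].
  eapply Dr_eq.
  + apply Dr_mult; [apply Dr_minus; [apply Dr_dpow_s, HF|apply Dr_scal, IH]|exact HI].
  + cbv beta.
    change (dprim (S (S k)) (F u) x) with
      ((dpow (S (S k)) (F u - 1) x - RtoC (INR (S (S k))) * dprim (S k) (F u) x) / (F u - 1))%C.
    rewrite (S_INR (S k)), RtoC_plus.
    cbn [dprim].
    field; exact H1'.
Qed.

Lemma Dr_pow_negln k x : 0 < x ->
  Dr (fun y => RtoC ((- ln y) ^ k)) x (RtoC (INR k * (- ln x) ^ pred k) * - / RtoC x)%C.
Proof.
intros Hx; eapply Dr_eq.
- apply (Dr_real (fun y => (- ln y) ^ k)); apply is_derive_pow.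
  apply (is_derive_opp ln); apply is_derive_ln, Hx.
- change (opp (/ x)) with (- / x).
  rewrite !RtoC_mult, RtoC_opp, RtoC_inv by lra; ring.
Qed.

Lemma Dr_dpow_x k (s : C) x : 0 < x ->
  Dr (dpow k s) x (- / RtoC x * (RtoC (INR k * (- ln x) ^ pred k) + s * RtoC ((- ln x) ^ k)) * rcpow x (- s))%C.
Proof.
intros Hx; pose proof (RtoC_neq_0 x ltac:(lra)); eapply Dr_eq.
- apply Dr_mult; [apply Dr_pow_negln, Hx|apply Dr_rcpow, Hx].
- cbv beta; field; assumption.
Qed.

(** [dprim k s] stands for the divergent integral of [dpow k s] over [[x, +oo)], hence
    the sign. *)
Lemma Dr_dprim_x k (s : C) x : s <> 1%C -> 0 < x -> Dr (dprim k s) x (- dpow k s x)%C.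
Proof.
intros Hs Hx; pose proof (sm1_neq_0 _ Hs) as Hs'; pose proof (RtoC_neq_0 x ltac:(lra)) as Hx'.
induction k as [|k IH].
- eapply Dr_ext; [intros y; cbn [dprim]; unfold Cdiv; reflexivity|].
  eapply Dr_eq; [apply Dr_mult; [apply Dr_dpow_x, Hx|apply Dr_const]|].
  replace (rcpow x (- (s - 1))) with (RtoC x * rcpow x (- s))%C.
  2:{ rewrite <- rcpow_1m by lra; f_equal; ring. }
  unfold dpow; simpl; rewrite Rmult_0_l; field; auto.
- eapply Dr_ext; [intros y; cbn [dprim]; unfold Cdiv; reflexivity|].
  eapply Dr_eq; [apply Dr_mult; [apply Dr_minus; [apply Dr_dpow_x, Hx|apply Dr_scal, IH]|apply Dr_const]|].
  cbv beta.
  replace (rcpow x (- (s - 1))) with (RtoC x * rcpow x (- s))%C.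
  2:{ rewrite <- rcpow_1m by lra; f_equal; ring. }
  unfold dpow; cbn [pred]; rewrite !RtoC_mult; field; auto.
Qed.

(** The [k]-th [s]-derivative of the [n]-th Euler-Maclaurin term
    [(m+1)^(-s) - int_m^(m+1) x^(-s) dx] with [m = n + 1], the integral being expressed by
    its primitive. *)
Definition ddiff (k : nat) (s : C) (n : nat) : C :=
  (dpow k s (INR (S n) + 1) + (dprim k s (INR (S n) + 1) - dprim k s (INR (S n))))%C.

Lemma Dr_ddiff_s k n F u l : Dr F u l -> F u <> 1%C ->
  Dr (fun y => ddiff k (F y) n) u (l * ddiff (S k) (F u) n)%C.
Proof.
intros H H1; unfold ddiff; eapply Dr_eq.
- apply Dr_plus; [apply Dr_dpow_s, H|apply Dr_minus; apply (Dr_dprim_s k _ F); [exact H|exact H1|exact H|exact H1]].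
- ring.
Qed.

(** A value minus a mean over a unit interval costs one derivative in [x], which gains
    a factor [1 / m]; this is what makes the series converge for [Re s > 0]. *)
Lemma ddiff_bound k (s : C) n : 0 <= Re s -> s <> 1%C ->
  Cmod (ddiff k s n) <=
  4 * ((INR k + Cmod s) * (1 + ln (INR (S n) + 1)) ^ k * exp (- (1 + Re s) * ln (INR (S n)))).
Proof.
intros Hs Hs1; pose proof (INR_S_ge1 n) as Hm; unfold ddiff.
set (m := INR (S n)) in *.
refine (kernel_bound (dpow k s) _ (dprim k s) _ m _ (fun x Hx => Dr_dpow_x k s x _) _).
- intros x Hx; apply Dr_dprim_x; [exact Hs1|lra].
- lra.
- intros x Hx.
  rewrite !Cmod_mult, Cmod_opp, Cmod_invR, Cmod_rcpow, re_opp by lra.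
  pose proof (ln_ge_0 x ltac:(lra)) as HL.
  pose proof (ln_le' m x ltac:(lra) ltac:(lra)) as HLm.
  pose proof (ln_le' x (m + 1) ltac:(lra) ltac:(lra)) as HLm1.
  set (W := 1 + ln (m + 1)).
  assert (HW : forall j, (j <= k)%nat -> Rabs ((- ln x) ^ j) <= W ^ k).
  { intros j Hj; rewrite <- RPow_abs, Rabs_Ropp, Rabs_pos_eq by exact HL.
    apply Rle_trans with (W ^ j); [apply pow_incr; unfold W; lra|].
    apply Rle_pow; [unfold W; lra|exact Hj]. }
  assert (H1 : Cmod (RtoC (INR k * (- ln x) ^ pred k) + s * RtoC ((- ln x) ^ k)) <= (INR k + Cmod s) * W ^ k).
  { eapply Rle_trans; [apply Cmod_triangle|].
    rewrite Cmod_mult, !Cmod_R, Rabs_mult, (Rabs_pos_eq (INR k)) by apply pos_INR.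
    rewrite Rmult_plus_distr_r; apply Rplus_le_compat; apply Rmult_le_compat_l;
      [apply pos_INR|apply HW; lia|apply Cmod_ge_0|apply HW; lia]. }
  assert (H2 : exp (- ln x) * exp (- Re s * ln x) <= exp (- (1 + Re s) * ln m)).
  { rewrite <- exp_plus; apply exp_le; nra. }
  pose proof (Cmod_ge_0 (RtoC (INR k * (- ln x) ^ pred k) + s * RtoC ((- ln x) ^ k))).
  pose proof (exp_pos (- ln x)); pose proof (exp_pos (- Re s * ln x)).
  apply Rle_trans with ((INR k + Cmod s) * W ^ k * (exp (- ln x) * exp (- Re s * ln x))).
  + rewrite (Rmult_comm (exp (- ln x))), Rmult_assoc; apply Rmult_le_compat_r; [nra|exact H1].
  + apply Rmult_le_compat_l; [nra|exact H2].
Qed.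

Lemma pow_ln_le_exp k q : 0 < q -> exists A, 0 < A /\ forall m, 1 <= m ->
  (1 + ln (m + 1)) ^ k <= A * exp (q * ln m).
Proof.
intros Hq.
assert (Hk : 0 < INR (S k)) by (pose proof (INR_S_ge1 k); lra).
(* [k r <= q], and [S k] in place of [k] covers [k = 0]. *)
set (r := q / INR (S k)).
assert (Hr : 0 < r) by (apply Rdiv_lt_0_compat; assumption).
exists ((/ r) ^ k * exp (2 * q)); split.
{ apply Rmult_lt_0_compat; [apply pow_lt, Rinv_0_lt_compat, Hr|apply exp_pos]. }
intros m Hm.
pose proof (ln_succ_bounds m ltac:(lra)) as [_ H].
assert (H' : / m <= 1) by (rewrite <- Rinv_1; apply Rinv_le_contravar; lra).
pose proof (ln_ge_0 m Hm) as HL.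
pose proof (ln_ge_0 (m + 1) ltac:(lra)) as HL1.
set (v := 2 + ln m).
assert (Hv : 1 + ln (m + 1) <= / r * exp (r * v)).
{ apply Rle_trans with v; [unfold v; lra|].
  pose proof (le_exp_div r v Hr); unfold Rdiv in *; lra. }
eapply Rle_trans; [apply pow_incr; split; [lra|exact Hv]|].
rewrite Rpow_mult_distr, Rmult_assoc.
apply Rmult_le_compat_l; [left; apply pow_lt, Rinv_0_lt_compat, Hr|].
rewrite <- exp_plus, <- Rpower_pow by apply exp_pos.
unfold Rpower; rewrite ln_exp; apply exp_le.
replace (2 * q + q * ln m) with (q * v) by (unfold v; ring).
rewrite <- Rmult_assoc; apply Rmult_le_compat_r; [unfold v; lra|].
unfold r; rewrite S_INR in *; pose proof (pos_INR k).
apply Rmult_le_reg_r with (INR k + 1); [lra|].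
field_simplify; [|lra]; nra.
Qed.

(** A power of [ln] is absorbed in half of the available exponent, so that one summable
    majorant serves for all [s] in a bounded part of the half-plane. *)
Lemma ddiff_majorant k a c : 0 < a -> 0 <= c -> exists b : nat -> R, exists lb : R,
  is_series b lb /\
  (forall (s : C) n, 2 * a <= Re s -> s <> 1%C -> Cmod s <= c -> Cmod (ddiff k s n) <= b n).
Proof.
intros Ha Hc.
destruct (pow_ln_le_exp k a Ha) as [A [HA H]].
destruct (p_summable a Ha) as [P HP].
exists (fun n => 4 * ((INR k + c) * A) * zt_p a n), (4 * ((INR k + c) * A) * P); split.
{ apply (is_series_scal (K := R_AbsRing) (V := R_NormedModule) _ _ _ HP). }
intros s n Hs Hs1 Hsc.
eapply Rle_trans; [apply ddiff_bound; [lra|exact Hs1]|].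
pose proof (INR_S_ge1 n) as Hm; unfold zt_p.
set (m := INR (S n)) in *.
rewrite !Rmult_assoc; apply Rmult_le_compat_l; [lra|].
pose proof (pos_INR k); pose proof (Cmod_ge_0 s).
pose proof (ln_ge_0 m Hm) as HL; pose proof (ln_ge_0 (m + 1) ltac:(lra)).
apply Rmult_le_compat; [lra| |lra|].
{ apply Rmult_le_pos; [apply pow_le; lra|left; apply exp_pos]. }
apply Rle_trans with (A * exp (a * ln m) * exp (- (1 + 2 * a) * ln m)).
- apply Rmult_le_compat; [apply pow_le; lra|left; apply exp_pos|apply H, Hm|].
  apply exp_le; nra.
- right; rewrite Rmult_assoc, <- exp_plus; do 2 f_equal; ring.
Qed.


(** * Derivatives of zeta of all orders *)

(** The chain rule along real curves is all of complex differentiability that Taylor's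
    inequality on segments needs, and it follows formally for [dpow] and [dprim]. *)
Definition curve_derivative (f f' : C -> C) : Prop :=
  forall (F : R -> C) u l, Dr F u l -> F u <> 1%C -> Dr (fun y => f (F y)) u (l * f' (F u))%C.

Lemma curve_derivative_quad (f f1 f2 : C -> C) (s : C) (r B : R) :
  curve_derivative f f1 -> curve_derivative f1 f2 ->
  (forall h, Cmod h <= r -> (s + h)%C <> 1%C) ->
  (forall h, Cmod h <= r -> Cmod (f2 (s + h)%C) <= B) ->
  forall h, Cmod h <= r ->
  Cmod (f (s + h)%C - f s - h * f1 s) <= 4 * B * (Cmod h * Cmod h).
Proof.
intros D1 D2 H1 HB h Hh.
assert (Hx : forall x, 0 <= x <= 1 -> Cmod (RtoC x * h) <= r).
{ intros x Hx; rewrite Cmod_mult, Cmod_R, Rabs_pos_eq by lra; pose proof (Cmod_ge_0 h); nra. }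
assert (HL : forall x, Dr (fun y => s + RtoC y * h)%C x h).
{ intros x; eapply Dr_eq; [apply Dr_plus; [apply Dr_const|apply Dr_mult; [apply Dr_id|apply Dr_const]]|].
  cbv beta; ring. }
pose proof (Cmod_ge_0 h) as Hh0.
assert (B0 : 0 <= B).
{ eapply Rle_trans; [apply Cmod_ge_0|apply (HB h Hh)]. }
assert (E0 : forall z, (s + RtoC 0 * z)%C = s) by (intros; ring).
assert (E1 : forall z, (s + RtoC 1 * z)%C = (s + z)%C) by (intros; ring).
pose proof (mvtC (fun y => f (s + RtoC y * h) - RtoC y * (h * f1 s))%C
  (fun x => h * (f1 (s + RtoC x * h) - f1 s))%C 0 1
  (Cmod h * (2 * (Cmod h * B)))) as Q.
cbv beta in Q; rewrite E0, E1 in Q.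
match type of Q with _ -> _ -> _ -> Cmod ?X <= _ => replace X with
  (f (s + h) - f s - h * f1 s)%C in Q by ring end.
eapply Rle_trans; [apply Q|]; [lra| | |right; ring].
- intros x Hx'; eapply Dr_eq; [apply Dr_minus; [apply D1; [apply HL|apply H1, Hx, Hx']|
    apply Dr_mult; [apply Dr_id|apply Dr_const]]|].
  cbv beta; ring.
- intros x Hx'; rewrite Cmod_mult; apply Rmult_le_compat_l; [exact Hh0|].
  assert (HD : forall y, 0 <= y <= x ->
    Dr (fun y => f1 (s + RtoC y * h)%C) y (h * f2 (s + RtoC y * h)%C)%C).
  { intros y Hy; apply (D2 (fun y => s + RtoC y * h)%C); [apply HL|apply H1, Hx; lra]. }
  pose proof (mvtC (fun y => f1 (s + RtoC y * h)%C) _ 0 x (Cmod h * B) ltac:(lra) HD) as Q2.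
  cbv beta in Q2; rewrite E0 in Q2.
  eapply Rle_trans; [apply Q2|].
  + intros y Hy; rewrite Cmod_mult; apply Rmult_le_compat_l; [exact Hh0|].
    apply HB, Hx; lra.
  + assert (0 <= Cmod h * B) by (apply Rmult_le_pos; assumption); nra.
Qed.

Lemma ddiff_curve k n : curve_derivative (fun s : C => ddiff k s n) (fun s : C => ddiff (S k) s n).
Proof. intros F u l; apply Dr_ddiff_s. Qed.

(** The part of the expansion of the [k]-th derivative that comes from [n = 1]; for
    [k = 0] it is [1 + 1 / (s - 1)]. *)
Definition dhead (k : nat) (s : C) : C := (dpow k s 1 + dprim k s 1)%C.

Lemma dhead_curve k : curve_derivative (dhead k) (dhead (S k)).
Proof.
intros F u l H H1; unfold dhead; eapply Dr_eq.
- apply Dr_plus; [apply Dr_dpow_s, H|apply (Dr_dprim_s k _ F); [exact H|exact H1]].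
- ring.
Qed.

Lemma dpow_1_bound k s : Cmod (dpow k s 1) <= 1.
Proof.
unfold dpow; rewrite Cmod_mult, Cmod_R, Cmod_rcpow, ln_1, Rmult_0_r, exp_0, Rmult_1_r, Ropp_0.
destruct k as [|k]; simpl; [rewrite Rabs_R1|rewrite Rmult_0_l, Rabs_R0]; lra.
Qed.

Lemma dhead_bound k d : 0 < d -> exists B, forall s : C, d <= Cmod (s - 1) -> Cmod (dhead k s) <= B.
Proof.
intros Hd.
assert (HB : exists B, 0 <= B /\ forall s : C, d <= Cmod (s - 1) -> Cmod (dprim k s 1) <= B).
{ assert (Hdiv : forall (z s : C) b, 0 <= b -> d <= Cmod (s - 1) -> Cmod z <= b -> Cmod (z / (s - 1)) <= b / d).
  { intros z s b Hb Hs Hz; rewrite Cmod_div.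
    - apply Rmult_le_compat; [apply Cmod_ge_0| |exact Hz|apply Rinv_le_contravar; assumption].
      left; apply Rinv_0_lt_compat; lra.
    - apply Cmod_gt_0; lra. }
  induction k as [|k [B [HB0 HB]]].
  - exists (1 / d); split; [apply Rdiv_le_0_compat; lra|].
    intros s Hs; apply Hdiv; [lra|exact Hs|apply dpow_1_bound].
  - pose proof (pos_INR (S k)) as Hk.
    assert (0 <= INR (S k) * B) by (apply Rmult_le_pos; assumption).
    exists ((1 + INR (S k) * B) / d); split; [apply Rdiv_le_0_compat; lra|].
    intros s Hs; cbn [dprim]; apply Hdiv; [lra|exact Hs|].
    eapply Rle_trans; [apply Cmod_minus_le|].
    apply Rplus_le_compat; [apply dpow_1_bound|].
    rewrite Cmod_mult, Cmod_R, Rabs_pos_eq by exact Hk.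
    apply Rmult_le_compat_l; [exact Hk|apply HB, Hs]. }
destruct HB as [B [_ HB]]; exists (1 + B); intros s Hs; unfold dhead.
eapply Rle_trans; [apply Cmod_triangle|].
apply Rplus_le_compat; [apply dpow_1_bound|apply HB, Hs].
Qed.

Lemma disc_away_from_pole (s : C) : 0 < Re s -> s <> 1%C -> exists r a d c, 0 < r /\ 0 < a /\ 0 < d /\ 0 <= c /\
  forall h, Cmod h <= r -> 2 * a <= Re (s + h)%C /\ d <= Cmod (s + h - 1) /\ Cmod (s + h) <= c.
Proof.
intros Hs Hs1.
assert (Hw' : 0 < Cmod (s - 1)) by (apply Cmod_gt_0, sm1_neq_0, Hs1).
exists (Rmin (Re s / 2) (Cmod (s - 1) / 2)), (Re s / 4), (Cmod (s - 1) / 2), (Cmod s + Re s).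
pose proof (Rmin_l (Re s / 2) (Cmod (s - 1) / 2)); pose proof (Rmin_r (Re s / 2) (Cmod (s - 1) / 2)).
pose proof (Cmod_ge_0 s).
repeat split; try lra.
- apply Rmin_glb_lt; lra.
- rewrite re_plus; pose proof (re_le_Cmod h) as Q; apply Rabs_le_between in Q; lra.
- pose proof (Cmod_minus_le (s + h - 1) h) as Q.
  replace (s + h - 1 - h)%C with (s - 1)%C in Q by ring; lra.
- pose proof (Cmod_triangle s h); lra.
Qed.

Lemma neq_1_of_dist (s : C) d : 0 < d -> d <= Cmod (s - 1) -> s <> 1%C.
Proof.
intros Hd H E; rewrite E in H; replace (1 - 1)%C with (RtoC 0) in H by ring.
rewrite Cmod_0 in H; lra.
Qed.

(** Term by term differentiation: the second order Taylor remainders of the terms are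
    dominated by a summable majorant of the terms of order [k + 2], so the remainder of
    the sum is quadratic in [h]. *)
Lemma zeta_derive_step (f : C -> C) k :
  (forall s : C, 0 < Re s -> s <> 1%C ->
     @is_series C_AbsRing C_NormedModule (ddiff k s) (f s - dhead k s)%C) ->
  forall s : C, 0 < Re s -> s <> 1%C -> exists L : C,
     @is_series C_AbsRing C_NormedModule (ddiff (S k) s) (L - dhead (S k) s)%C /\
     @is_derive C_AbsRing C_NormedModule f s L.
Proof.
intros Hf s Hs Hs1.
destruct (disc_away_from_pole s Hs Hs1) as (r & a & d & c & Hr & Ha & Hd & Hc & Hdisc).
assert (Hne : forall h, Cmod h <= r -> (s + h)%C <> 1%C).
{ intros h Hh; apply (neq_1_of_dist _ d Hd), Hdisc, Hh. }
destruct (ddiff_majorant (S k) a c Ha Hc) as (b1 & lb1 & Hb1 & Hm1).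
destruct (ddiff_majorant (S (S k)) a c Ha Hc) as (b2 & lb2 & Hb2 & Hm2).
destruct (dhead_bound (S (S k)) d Hd) as [B HB].
assert (Es : (s + 0)%C = s) by ring.
assert (HL : exists L : C, @is_series C_AbsRing C_NormedModule (ddiff (S k) s) L).
{ apply (@ex_series_le C_AbsRing C_CompleteNormedModule _ b1); [|eexists; exact Hb1].
  destruct (Hdisc 0%C) as (D1 & D2 & D3); [rewrite Cmod_0; lra|]; rewrite Es in *.
  intros n; apply Hm1; assumption. }
destruct HL as [L HL].
exists (L + dhead (S k) s)%C; split.
{ replace (L + dhead (S k) s - dhead (S k) s)%C with L by ring; exact HL. }
apply (quadratic_derive _ _ _ (4 * lb2 + 4 * B) r Hr).
intros h Hh.
assert (Hser : @is_series C_AbsRing C_NormedModule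
  (fun n => ddiff k (s + h) n - ddiff k s n - h * ddiff (S k) s n)%C
  (f (s + h)%C - dhead k (s + h) - (f s - dhead k s) - h * L)%C).
{ destruct (Hdisc h Hh) as (D1 & D2 & D3).
  apply (is_series_minus (K := C_AbsRing) (V := C_NormedModule)).
  - apply (is_series_minus (K := C_AbsRing) (V := C_NormedModule)); apply Hf; auto; lra.
  - apply (is_series_scal (K := C_AbsRing) (V := C_NormedModule)), HL. }
assert (Q1 : Cmod (f (s + h)%C - dhead k (s + h) - (f s - dhead k s) - h * L) <= 4 * (Cmod h * Cmod h) * lb2).
{ apply (C_series_bound _ _ _ _ Hser
    (is_series_scal (K := R_AbsRing) (V := R_NormedModule) (4 * (Cmod h * Cmod h)) _ _ Hb2)).
  intros n.
  change (Cmod (ddiff k (s + h) n - ddiff k s n - h * ddiff (S k) s n) <= 4 * (Cmod h * Cmod h) * b2 n).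
  replace (4 * (Cmod h * Cmod h) * b2 n) with (4 * b2 n * (Cmod h * Cmod h)) by ring.
  apply (curve_derivative_quad (fun s : C => ddiff k s n) (fun s : C => ddiff (S k) s n)
    (fun s : C => ddiff (S (S k)) s n) s r); auto using ddiff_curve.
  intros h' Hh'; destruct (Hdisc h' Hh') as (D1 & D2 & D3); apply Hm2; auto. }
assert (Q2 : Cmod (dhead k (s + h) - dhead k s - h * dhead (S k) s) <= 4 * B * (Cmod h * Cmod h)).
{ apply (curve_derivative_quad (dhead k) (dhead (S k)) (dhead (S (S k))) s r); auto using dhead_curve.
  intros h' Hh'; apply HB, Hdisc, Hh'. }
replace (f (s + h)%C - f s - h * (L + dhead (S k) s))%C with
  ((f (s + h)%C - dhead k (s + h) - (f s - dhead k s) - h * L)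
   + (dhead k (s + h) - dhead k s - h * dhead (S k) s))%C by ring.
eapply Rle_trans; [apply Cmod_triangle|]; lra.
Qed.

Lemma dpow_0 s x : dpow 0 s x = rcpow x (- s).
Proof. unfold dpow; simpl; ring. Qed.

Lemma zeta_derive_n_series k : forall s : C, 0 < Re s -> s <> 1%C ->
  @is_series C_AbsRing C_NormedModule (ddiff k s) (C_derive_n zeta k s - dhead k s)%C.
Proof.
induction k as [|k IH]; intros s Hs Hs1.
- assert (E : forall x, dprim 0 s x = zt_g s x).
  { intros x; cbn [dprim]; rewrite dpow_0; unfold zt_g; do 2 f_equal; ring. }
  refine (eq_rect _ (fun z => @is_series C_AbsRing C_NormedModule _ z) _ _ _).
  + eapply is_series_ext; [|apply (zeta_series s Hs Hs1)].
    intros n; unfold ddiff, zt_d; rewrite dpow_0, !E; reflexivity.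
  + simpl C_derive_n; unfold dhead; rewrite E, dpow_0.
    unfold zeta_approx, zt_g; rewrite sum_O; change (INR 1) with 1; reflexivity.
- destruct (zeta_derive_step _ k IH s Hs Hs1) as (L & HL & HD).
  simpl C_derive_n; rewrite (is_C_derive_unique _ _ _ HD); exact HL.
Qed.

Lemma zeta_derive_n_ex_derive k (s : C) : 0 < Re s -> s <> 1%C ->
  @ex_derive C_AbsRing C_NormedModule (C_derive_n zeta k) s.
Proof.
intros Hs Hs1.
destruct (zeta_derive_step _ k (zeta_derive_n_series k) s Hs Hs1) as (L & _ & HD).
exists L; exact HD.
Qed.

(** * Sums over lists *)

Definition lsum {X : Type} (f : X -> R) (L : list X) : R := fold_right (fun x a => f x + a) 0 L.

Lemma lsum_app {X} (f : X -> R) L1 L2 : lsum f (L1 ++ L2) = lsum f L1 + lsum f L2.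
Proof. induction L1 as [|x L1 IH]; simpl; [|rewrite IH]; ring. Qed.

Lemma lsum_le {X} (f g : X -> R) L : (forall x, In x L -> f x <= g x) -> lsum f L <= lsum g L.
Proof.
induction L as [|x L IH]; intros H; simpl; [lra|].
apply Rplus_le_compat; [apply H; left; reflexivity|apply IH; intros; apply H; right; assumption].
Qed.

Lemma lsum_ext {X} (f g : X -> R) L : (forall x, In x L -> f x = g x) -> lsum f L = lsum g L.
Proof. intros H; apply Rle_antisym; apply lsum_le; intros x Hx; rewrite (H x Hx); lra. Qed.

Lemma lsum_plus {X} (f g : X -> R) L : lsum (fun x => f x + g x) L = lsum f L + lsum g L.
Proof. induction L as [|x L IH]; simpl; [|rewrite IH]; ring. Qed.

Lemma lsum_scal {X} c (f : X -> R) L : lsum (fun x => c * f x) L = c * lsum f L.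
Proof. induction L as [|x L IH]; simpl; [|rewrite IH]; ring. Qed.

Lemma lsum_const {X} c (L : list X) : lsum (fun _ => c) L = c * INR (length L).
Proof. induction L as [|x L IH]; simpl length; [simpl; ring|]; rewrite S_INR; simpl; rewrite IH; ring. Qed.

Lemma lsum_nonneg {X} (f : X -> R) L : (forall x, In x L -> 0 <= f x) -> 0 <= lsum f L.
Proof.
intros H; replace 0 with (lsum (fun _ => 0) L) by (rewrite lsum_const; ring); apply lsum_le, H.
Qed.

Lemma lsum_map {X Y : Type} (f : Y -> R) (g : X -> Y) L : lsum f (map g L) = lsum (fun x => f (g x)) L.
Proof. induction L as [|x L IH]; simpl; [|rewrite IH]; reflexivity. Qed.

Lemma lsum_list_prod {X Y : Type} (f : X * Y -> R) A B :
  lsum f (list_prod A B) = lsum (fun a => lsum (fun b => f (a, b)) B) A.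
Proof. induction A as [|a A IH]; simpl; [reflexivity|]; rewrite lsum_app, lsum_map, IH; reflexivity. Qed.

Lemma lsum_exchange {X Y : Type} (f : X -> Y -> R) A B :
  lsum (fun a => lsum (f a) B) A = lsum (fun b => lsum (fun a => f a b) A) B.
Proof.
induction A as [|a A IH]; simpl.
- rewrite lsum_const; ring.
- rewrite IH, <- lsum_plus; reflexivity.
Qed.

(** * Approximation of the derivatives on the line Re s = 1 *)

(** The primitives telescope: a partial sum of the Euler-Maclaurin terms is a partial
    Dirichlet sum plus one boundary term. *)
Lemma dhead_sum l (s : C) N :
  (dhead l s + @sum_n C_AbelianGroup (ddiff l s) N)%C =
  (@sum_n C_AbelianGroup (fun n => dpow l s (INR (S n))) (S N) + dprim l s (INR (S (S N))))%C.
Proof.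
induction N as [|N IH].
- rewrite sum_Sn, !sum_O; unfold dhead, ddiff; rewrite (S_INR 1); change (INR 1) with 1.
  change (@plus C_AbelianGroup) with Cplus; ring.
- rewrite sum_Sn, (sum_Sn _ (S N)); change (@plus C_AbelianGroup) with Cplus in *.
  rewrite Cplus_assoc, IH; unfold ddiff; rewrite (S_INR (S (S N))); ring.
Qed.

(** [1 + ln w] exceeds [1 + ln V] by a factor of at most
    [exp (ln (w / V) / (1 + ln V))]; its [l]-th power costs only [(w / V) ^ (1/2)] as long
    as [2 l <= 1 + ln V].  So the [l]-th power of the logarithm can be frozen at the start
    of a tail. *)
Lemma pow_ln_growth l V w : 1 <= V -> 2 * INR l <= 1 + ln V -> V <= w ->
  (1 + ln w) ^ l <= (1 + ln V) ^ l * sqrt w.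
Proof.
intros HV Hl Hw.
pose proof (ln_ge_0 V HV) as HL; pose proof (ln_le' V w ltac:(lra) Hw) as HLw.
set (A := 1 + ln V) in *.
assert (H1 : 1 + ln w <= A * exp ((ln w - ln V) / A)).
{ pose proof (exp_ineq1_le ((ln w - ln V) / A)) as Q.
  replace (1 + ln w) with (A * (1 + (ln w - ln V) / A)) by (unfold A; field; unfold A in *; lra).
  apply Rmult_le_compat_l; [unfold A; lra|exact Q]. }
eapply Rle_trans; [apply pow_incr; split; [lra|exact H1]|].
rewrite Rpow_mult_distr; apply Rmult_le_compat_l; [apply pow_le; unfold A; lra|].
rewrite <- Rpower_pow by apply exp_pos; unfold Rpower; rewrite ln_exp.
replace (sqrt w) with (exp (ln w / 2)).
2:{ rewrite <- Rpower_sqrt by lra; unfold Rpower; f_equal; field. }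
apply exp_le.
pose proof (pos_INR l) as Hl0.
replace (INR l * ((ln w - ln V) / A)) with ((INR l / A) * (ln w - ln V)) by (field; unfold A; lra).
apply Rle_trans with (/ 2 * (ln w - ln V)); [|lra].
apply Rmult_le_compat_r; [lra|].
apply Rmult_le_reg_r with A; [unfold A; lra|].
replace (INR l / A * A) with (INR l) by (field; unfold A; lra); lra.
Qed.

Lemma sqrt_telescope m : 1 <= m ->
  sqrt (m + 1) * exp (- (1 + 1) * ln m) <= 8 * (/ sqrt m - / sqrt (m + 1)).
Proof.
intros Hm.
replace (exp (- (1 + 1) * ln m)) with (/ (m * m)).
2:{ replace (- (1 + 1) * ln m) with (- ln m + - ln m) by ring.
    rewrite exp_plus, <- inv_exp_ln by lra; rewrite Rinv_mult; reflexivity. }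
pose proof (sqrt_lt_R0 m ltac:(lra)) as Ha; pose proof (sqrt_lt_R0 (m + 1) ltac:(lra)) as Hb.
pose proof (sqrt_sqrt m ltac:(lra)) as Ea; pose proof (sqrt_sqrt (m + 1) ltac:(lra)) as Eb.
set (a := sqrt m) in *; set (b := sqrt (m + 1)) in *.
assert (Hab : b * b = a * a + 1) by lra.
assert (H1a : 1 <= a) by nra.
assert (Hb2 : b <= 2 * a) by nra.
replace (m * m) with (a * a * (a * a)) by (rewrite Ea; ring).
replace (8 * (/ a - / b)) with (8 / (a * b * (a + b))).
2:{ replace (/ a - / b) with ((b - a) * / (a * b)) by (field; lra).
    replace (b - a) with (/ (a + b)).
    - field; repeat split; try lra.
    - apply Rmult_eq_reg_r with (a + b); [|lra]. rewrite Rinv_l by lra; nra. }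
assert (Hab2 : b * b <= 2 * (a * a)) by nra.
apply Rmult_le_reg_r with (a * a * (a * a) * (a * b * (a + b))).
{ repeat apply Rmult_lt_0_compat; lra. }
replace (b * / (a * a * (a * a)) * (a * a * (a * a) * (a * b * (a + b))))
  with (a * (b * b * (a + b))) by (field; lra).
replace (8 / (a * b * (a + b)) * (a * a * (a * a) * (a * b * (a + b))))
  with (a * (8 * (a * (a * a)))) by (field; lra).
apply Rmult_le_compat_l; [lra|].
apply Rle_trans with (2 * (a * a) * (3 * a)); [apply Rmult_le_compat; nra|nra].
Qed.

Lemma is_series_inv_sqrt N :
  is_series (fun k => / sqrt (INR (S (N + k))) - / sqrt (INR (S (N + k)) + 1)) (/ sqrt (INR (S N))).
Proof.
set (u := fun k => / sqrt (INR (S (N + k)))).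
assert (Hu : filterlim u eventually (locally (@zero R_NormedModule))).
{ change (is_lim_seq u 0).
  replace (Finite 0) with (Rbar_inv p_infty) by reflexivity.
  apply is_lim_seq_inv; [|discriminate].
  apply (filterlim_comp _ _ _ (fun k => INR (S (N + k))) sqrt _ (Rbar_locally p_infty)).
  - apply (is_lim_seq_ext (fun n => INR (n + S N))).
    { intros n; f_equal; lia. }
    apply (is_lim_seq_incr_n INR (S N)), is_lim_seq_INR.
  - apply filterlim_sqrt_p. }
pose proof (is_series_telescope (K := R_AbsRing) (V := R_NormedModule) u Hu) as Q.
unfold u in Q at 3; rewrite Nat.add_0_r in Q.
eapply is_series_ext; [|exact Q].
intros n; unfold u.
change (/ sqrt (INR (S (N + n))) - / sqrt (INR (S (N + S n))) =
  / sqrt (INR (S (N + n))) - / sqrt (INR (S (N + n)) + 1)).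
rewrite Nat.add_succ_r, (S_INR (S (N + n))); reflexivity.
Qed.

Lemma zeta_derive_tail l t N : 0 < t -> 2 * INR l <= 1 + ln (INR (S (S (S N)))) ->
  Cmod (C_derive_n zeta l (1, t) -
    (@sum_n C_AbelianGroup (fun n => dpow l (1, t) (INR (S n))) (S N)
      + dprim l (1, t) (INR (S (S N)))))
  <= 32 * (INR l + 1 + t) * (1 + ln (INR (S (S (S N))))) ^ l * / sqrt (INR (S (S N))).
Proof.
intros Ht Hl.
set (s := (1, t) : C).
assert (Hs : 0 < Re s) by (unfold s; simpl; lra).
assert (Hs1 : s <> 1%C) by (intros E; inversion E; lra).
rewrite <- dhead_sum.
set (V := INR (S (S (S N)))) in *.
assert (HS : @is_series C_AbsRing C_NormedModule (fun k => ddiff l s (S N + k))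
  (C_derive_n zeta l s - (dhead l s + @sum_n C_AbelianGroup (ddiff l s) N))%C).
{ apply (is_series_incr_n (K := C_AbsRing) (V := C_NormedModule) (ddiff l s) (S N)); [lia|].
  simpl pred.
  replace (plus _ _) with (C_derive_n zeta l s - dhead l s)%C; [apply zeta_derive_n_series; assumption|].
  change (C_derive_n zeta l s - dhead l s = C_derive_n zeta l s
    - (dhead l s + @sum_n C_AbelianGroup (ddiff l s) N) + @sum_n C_AbelianGroup (ddiff l s) N)%C.
  ring. }
set (c := 32 * (INR l + 1 + t) * (1 + ln V) ^ l).
apply (C_series_bound _ _ _ _ HS
    (is_series_scal (K := R_AbsRing) (V := R_NormedModule) c _ _ (is_series_inv_sqrt (S N)))).
intros n.
change (Cmod (ddiff l s (S N + n)) <= c * (/ sqrt (INR (S (S N + n))) - / sqrt (INR (S (S N + n)) + 1))).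
eapply Rle_trans; [apply ddiff_bound; [lra|exact Hs1]|].
pose proof (INR_S_ge1 (S N + n)) as Hm.
assert (HV1 : 1 <= V) by apply INR_S_ge1.
assert (HVm : V <= INR (S (S N + n)) + 1).
{ rewrite <- S_INR; apply le_INR; lia. }
set (m := INR (S (S N + n))) in *.
pose proof (pow_ln_growth l V (m + 1) HV1 Hl HVm) as Q1.
pose proof (sqrt_telescope m Hm) as Q2.
assert (Hmod : Cmod s <= 1 + t).
{ eapply Rle_trans; [apply Cmod_le_ReIm|]; unfold s; simpl; rewrite !Rabs_pos_eq; lra. }
pose proof (Cmod_ge_0 s); pose proof (pos_INR l).
pose proof (ln_ge_0 V HV1).
assert (HP : 0 <= (1 + ln V) ^ l) by (apply pow_le; lra).
change (Re s) with 1.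
apply Rle_trans with (4 * ((INR l + 1 + t) * ((1 + ln V) ^ l * sqrt (m + 1)) * exp (- (1 + 1) * ln m))).
- apply Rmult_le_compat_l; [lra|].
  apply Rmult_le_compat_r; [left; apply exp_pos|].
  apply Rmult_le_compat; [lra| |lra|exact Q1].
  apply pow_le; pose proof (ln_ge_0 (m + 1) ltac:(lra)); lra.
- unfold c.
  replace (4 * ((INR l + 1 + t) * ((1 + ln V) ^ l * sqrt (m + 1)) * exp (- (1 + 1) * ln m)))
    with (4 * (INR l + 1 + t) * (1 + ln V) ^ l * (sqrt (m + 1) * exp (- (1 + 1) * ln m))) by ring.
  eapply Rle_trans; [apply Rmult_le_compat_l; [|exact Q2]|right; ring].
  apply Rmult_le_pos; [lra|exact HP].
Qed.

(** On the line [Re s = 1] the division by [s - 1] is a division by [t], which beats the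
    factor [k] of the recurrence; the leading term dominates. *)
Lemma dprim_line1_bound k t x : 0 < t -> 1 <= x -> 2 * INR k <= t * ln x ->
  Cmod (dprim k (1, t) x) <= 2 * ln x ^ k / t.
Proof.
intros Ht Hx; pose proof (ln_ge_0 x Hx) as HL.
assert (Es : ((1, t) - 1)%C = (0, t)) by (unfold Cminus, Cplus, Copp, RtoC; simpl; f_equal; ring).
assert (Hmod : Cmod (0, t) = t).
{ unfold Cmod; simpl; replace (0 * (0 * 1) + t * (t * 1)) with (t ^ 2) by ring.
  apply sqrt_pow2; lra. }
assert (Hne : ((0, t) : C) <> 0%C) by (intros E; inversion E; lra).
assert (HP : forall j, Cmod (dpow j (0, t) x) = ln x ^ j).
{ intros j; unfold dpow; rewrite Cmod_mult, Cmod_R, Cmod_rcpow, <- RPow_abs, Rabs_Ropp, Rabs_pos_eq by exact HL.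
  simpl Re; replace (- 0 * ln x) with 0 by ring; rewrite exp_0; ring. }
induction k as [|k IH]; intros Hk; cbn [dprim]; rewrite Es, Cmod_div, Hmod by exact Hne;
  apply Rmult_le_compat_r; try (left; apply Rinv_0_lt_compat; exact Ht).
- rewrite HP; simpl; lra.
- eapply Rle_trans; [apply Cmod_minus_le|].
  rewrite HP, Cmod_mult, Cmod_R, Rabs_pos_eq by apply pos_INR.
  rewrite S_INR in *; pose proof (pos_INR k) as Hk0.
  specialize (IH ltac:(lra)).
  assert (HX : 0 <= ln x ^ k) by (apply pow_le, HL).
  assert (HY : (INR k + 1) * Cmod (dprim k (1, t) x) <= ln x * ln x ^ k); [|simpl; lra].
  apply Rle_trans with ((INR k + 1) * (2 * ln x ^ k / t)); [apply Rmult_le_compat_l; lra|].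
  apply Rmult_le_reg_r with t; [exact Ht|].
  replace ((INR k + 1) * (2 * ln x ^ k / t) * t) with (2 * (INR k + 1) * ln x ^ k) by (field; lra).
  replace (ln x * ln x ^ k * t) with (t * ln x * ln x ^ k) by ring.
  apply Rmult_le_compat_r; lra.
Qed.

(** The real part of [sum_(n <= N) (ln n)^l n^(-1-it)], that is, up to the sign
    [(-1)^l], of a partial sum of the Dirichlet series of the [l]-th derivative of zeta. *)
Definition logsum (l N : nat) (t : R) : R :=
  lsum (fun n => ln (INR n) ^ l / INR n * cos (t * ln (INR n))) (seq 1 N).

Lemma logsum_le_Cmod l N t :
  logsum l (S N) t <= Cmod (@sum_n C_AbelianGroup (fun n => dpow l (1, t) (INR (S n))) N).
Proof.
assert (E : Re (@sum_n C_AbelianGroup (fun n => dpow l (1, t) (INR (S n))) N)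
  = (-1) ^ l * logsum l (S N) t).
{ assert (E1 : forall n, Re (dpow l (1, t) (INR (S n))) =
    (-1) ^ l * (ln (INR (S n)) ^ l / INR (S n) * cos (t * ln (INR (S n))))).
  { intros n; pose proof (INR_S_ge1 n).
    unfold dpow; rewrite re_scal_l; unfold rcpow, Cexp; rewrite !re_scal_l, !im_scal_l.
    change (Re (- (1, t))%C) with (Ropp 1); change (Im (- (1, t))%C) with (- t).
    cbn [Re Im fst snd].
    replace (ln (INR (S n)) * Ropp 1) with (- ln (INR (S n))) by ring.
    replace (ln (INR (S n)) * - t) with (- (t * ln (INR (S n)))) by ring.
    rewrite cos_neg, <- inv_exp_ln by lra.
    replace (- ln (INR (S n))) with (-1 * ln (INR (S n))) by ring.
    rewrite Rpow_mult_distr; unfold Rdiv; ring. }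
  induction N as [|N IH].
  - rewrite sum_O, E1; unfold logsum; simpl seq; unfold lsum; cbn [fold_right]; ring.
  - rewrite sum_Sn; change (@plus C_AbelianGroup) with Cplus; rewrite re_plus, IH, E1.
    unfold logsum; rewrite (seq_S (S N)), lsum_app; unfold lsum at 3; cbn [fold_right Nat.add].
    ring. }
pose proof (re_le_Cmod (@sum_n C_AbelianGroup (fun n => dpow l (1, t) (INR (S n))) N)) as Q.
rewrite E, Rabs_mult, pow_1_abs, Rmult_1_l in Q.
eapply Rle_trans; [apply Rle_abs|exact Q].
Qed.

(** The hypothesis on [l] says exactly this: [(ln T) ^ l = exp (l ln ln T)]. *)
Lemma ln_pow_le l T : exp (exp 1) <= T -> INR l <= ln T / ln (ln T) -> ln T ^ l <= T.
Proof.
intros HT Hl.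
assert (Hx : exp 1 <= ln T).
{ rewrite <- (ln_exp (exp 1)); apply ln_le'; [apply exp_pos|exact HT]. }
assert (Hxx : 1 <= ln (ln T)).
{ rewrite <- (ln_exp 1); apply ln_le'; [apply exp_pos|exact Hx]. }
pose proof (exp_pos 1); pose proof (exp_pos (exp 1)).
apply Rle_trans with (exp (ln T)); [|right; apply exp_ln; lra].
rewrite <- Rpower_pow by lra; unfold Rpower; apply exp_le.
apply Rmult_le_reg_r with (/ ln (ln T)); [apply Rinv_0_lt_compat; lra|].
rewrite Rmult_assoc, Rinv_r, Rmult_1_r by lra; exact Hl.
Qed.

(** With [N] about [T ^ 4] both the tail and the boundary term are
    [O ((6 ln T) ^ l / T)], and [(ln T) ^ l <= T] leaves an error [O (6 ^ l)], negligible
    against [(ln ln T) ^ (l + 1) / (l + 1)]. *)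
Lemma logsum_le_derive l T t N :
  exp (exp 1) <= T -> T <= t <= 2 * T -> INR l <= ln T / ln (ln T) ->
  T ^ 4 <= INR (S (S N)) -> INR (S (S (S N))) <= T ^ 5 ->
  logsum l (S (S N)) t <= Cmod (C_derive_n zeta l (1, t)) + 130 * 6 ^ l.
Proof.
intros HT Ht Hl HN1 HN2.
assert (He : 2 <= exp 1) by (pose proof (exp_ineq1_le 1); lra).
assert (HT2 : 3 <= T) by (pose proof (exp_ineq1_le (exp 1)); lra).
assert (Hx : exp 1 <= ln T).
{ rewrite <- (ln_exp (exp 1)); apply ln_le'; [apply exp_pos|exact HT]. }
assert (Hxx : 1 <= ln (ln T)).
{ rewrite <- (ln_exp 1); apply ln_le'; [apply exp_pos|exact Hx]. }
set (x := ln T) in *; set (y := ln x) in *.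
assert (Hlx : INR l <= x).
{ eapply Rle_trans; [exact Hl|]; unfold Rdiv.
  apply Rle_trans with (x * 1); [|lra]; apply Rmult_le_compat_l; [lra|].
  rewrite <- Rinv_1; apply Rinv_le_contravar; lra. }
assert (HxlT : x ^ l <= T) by (apply ln_pow_le; assumption).
pose proof (pos_INR l) as Hl0.
set (V := INR (S (S (S N)))) in *; set (P := INR (S (S N))) in *.
assert (HPV : P <= V) by (apply le_INR; lia).
assert (HT4 : 0 < T ^ 4) by (apply pow_lt; lra).
assert (HlnP : 4 * x <= ln P).
{ unfold x; replace (4 * ln T) with (ln (T ^ 4)).
  - apply ln_le'; assumption.
  - rewrite ln_pow by lra; simpl; ring. }
assert (HlnV : ln V <= 5 * x).
{ unfold x; replace (5 * ln T) with (ln (T ^ 5)).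
  - apply ln_le'; lra.
  - rewrite ln_pow by lra; simpl; ring. }
pose proof (ln_le' P V ltac:(lra) HPV) as HlnPV.
assert (HP1 : 1 <= P) by apply INR_S_ge1.
pose proof (zeta_derive_tail l t N ltac:(lra) ltac:(fold V; lra)) as Q1.
pose proof (dprim_line1_bound l t P ltac:(lra) HP1 ltac:(nra)) as Q2.
pose proof (logsum_le_Cmod l (S N) t) as Q3.
fold V in Q1; fold P in Q1.
set (Z := C_derive_n zeta l (1, t)) in *.
set (S0 := @sum_n C_AbelianGroup (fun n => dpow l (1, t) (INR (S n))) (S N)) in *.
set (D := dprim l (1, t) P) in *.
assert (B1 : 32 * (INR l + 1 + t) * (1 + ln V) ^ l * / sqrt P <= 128 * 6 ^ l).
{ assert (Hs : T ^ 2 <= sqrt P).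
  { rewrite <- (sqrt_pow2 (T ^ 2)) by (apply pow_le; lra).
    apply sqrt_le_1_alt; replace ((T ^ 2) ^ 2) with (T ^ 4) by ring; exact HN1. }
  assert (Hp : (1 + ln V) ^ l <= 6 ^ l * T).
  { apply Rle_trans with ((6 * x) ^ l); [apply pow_incr; lra|].
    rewrite Rpow_mult_distr; apply Rmult_le_compat_l; [apply pow_le; lra|exact HxlT]. }
  assert (HxT : x <= T - 1).
  { unfold x; pose proof (exp_ineq1_le (ln T)) as Q; rewrite exp_ln in Q by lra; lra. }
  assert (H6 : 0 < 6 ^ l) by (apply pow_lt; lra).
  assert (HT2' : 0 < T ^ 2) by (apply pow_lt; lra).
  apply Rle_trans with (32 * (4 * T) * (6 ^ l * T) * / T ^ 2); [|right; field; lra].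
  apply Rmult_le_compat; [| left; apply Rinv_0_lt_compat; lra| |apply Rinv_le_contravar; assumption].
  { apply Rmult_le_pos; [lra|apply pow_le; lra]. }
  apply Rmult_le_compat; [lra|apply pow_le; lra|lra|exact Hp]. }
assert (B2 : 2 * ln P ^ l / t <= 2 * 6 ^ l).
{ unfold Rdiv; rewrite Rmult_assoc; apply Rmult_le_compat_l; [lra|].
  apply Rmult_le_reg_r with t; [lra|].
  rewrite Rmult_assoc, Rinv_l, Rmult_1_r by lra.
  apply Rle_trans with ((6 * x) ^ l); [apply pow_incr; lra|].
  rewrite Rpow_mult_distr; apply Rmult_le_compat_l; [apply pow_le; lra|lra]. }
assert (Q4 : Cmod S0 <= Cmod Z + (Cmod (Z - (S0 + D)) + Cmod D)).
{ replace S0 with (Z - ((Z - (S0 + D)) + D))%C at 1 by ring.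
  eapply Rle_trans; [apply Cmod_minus_le|]; apply Rplus_le_compat_l, Cmod_triangle. }
lra.
Qed.

Lemma zeta_derive_is_max l a b : 0 < a -> a <= b ->
  exists M, is_max_on (fun t => Cmod (C_derive_n zeta l (1, t))) a b M.
Proof.
intros Ha Hab.
set (f := fun t => Cmod (C_derive_n zeta l (1, t))).
destruct (continuity_ab_maj f a b Hab) as [t0 [H1 H2]].
- intros t Ht; apply continuity_pt_filterlim.
  assert (Hc : continuous (T := AbsRing_UniformSpace C_AbsRing) (U := C_NormedModule) (C_derive_n zeta l) (1, t)).
  { apply (@ex_derive_continuous C_AbsRing C_NormedModule), zeta_derive_n_ex_derive.
    - simpl; lra.
    - intros E; inversion E; lra. }
  unfold f.
  apply (filterlim_comp _ _ _ (fun t => C_derive_n zeta l (1, t)) Cmod (locally t)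
    (@locally C_NormedModule (C_derive_n zeta l (1, t)))).
  + apply (filterlim_comp _ _ _ (fun t : R => ((1, t) : C)) (C_derive_n zeta l) (locally t)
      (@locally (AbsRing_UniformSpace C_AbsRing) (1, t))); [|exact Hc].
    intros P [eps HP]; exists eps; intros y Hy; apply HP.
    change (Cmod ((1, y) - (1, t)) < eps).
    replace ((1, y) - (1, t))%C with (Ci * RtoC (y - t)%R)%C.
    * rewrite Cmod_mult, Cmod_Ci, Cmod_R, Rmult_1_l; exact Hy.
    * unfold Ci, RtoC, Cmult, Cminus, Cplus, Copp; simpl; f_equal; ring.
  + apply (@filterlim_norm C_AbsRing C_NormedModule).
- exists (f t0); split; [exists t0; split; [exact H2|reflexivity]|exact H1].
Qed.

(** * Averages of cosine sums *)

(** The factor by which averaging over an interval of length [h] multiplies an oscillation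
    of frequency [v], apart from a shift of its phase. *)
Definition sinc_factor (h v : R) : R := if Req_EM_T v 0 then 1 else 2 * sin (v * h / 2) / (v * h).

Lemma lsum_is_derive {X : Type} (f f' : X -> R -> R) L t :
  (forall x, In x L -> is_derive (f x) t (f' x t)) ->
  is_derive (fun t => lsum (fun x => f x t) L) t (lsum (fun x => f' x t) L).
Proof.
induction L as [|x L IH]; intros H; simpl.
- apply (@is_derive_const R_AbsRing R_NormedModule).
- apply (@is_derive_plus R_AbsRing R_NormedModule); [apply H; left; reflexivity|].
  apply IH; intros; apply H; right; assumption.
Qed.

(** The mean over [[t, t + h]] of a function that is nonnegative there is nonnegative;
    for a cosine sum this mean is again a cosine sum.  It is written as a difference
    quotient of the primitive, so that the mean value theorem replaces integration. *)
Lemma cos_sum_average {X : Type} (L : list X) (c u p : X -> R) h a b : 0 < h ->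
  (forall x, In x L -> u x = 0 -> p x = 0) ->
  (forall t, a <= t <= b + h -> 0 <= lsum (fun x => c x * cos (u x * t + p x)) L) ->
  forall t, a <= t <= b ->
  0 <= lsum (fun x => c x * sinc_factor h (u x) * cos (u x * t + (p x + u x * h / 2))) L.
Proof.
intros Hh Hp HG t Ht.
set (P := fun x t => c x * (if Req_EM_T (u x) 0 then t else sin (u x * t + p x) / u x)).
assert (HD : forall y, is_derive (fun t => lsum (fun x => P x t) L) y
   (lsum (fun x => c x * cos (u x * y + p x)) L)).
{ intros y; apply (lsum_is_derive P (fun x y => c x * cos (u x * y + p x))); intros x Hx; unfold P.
  destruct (Req_EM_T (u x) 0) as [E|E].
  - rewrite (Hp x Hx E), E; replace (0 * y + 0) with 0 by ring; rewrite cos_0.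
    auto_derive; [exact I|ring].
  - auto_derive; [exact I|field; exact E]. }
destruct (MVT_gen (fun t => lsum (fun x => P x t) L) t (t + h)
   (fun y => lsum (fun x => c x * cos (u x * y + p x)) L)) as [y [Hy E]].
- intros; apply HD.
- intros y Hy; apply continuity_pt_filterlim, (@ex_derive_continuous R_AbsRing R_NormedModule).
  eexists; apply HD.
- rewrite Rmin_left, Rmax_right in Hy by lra.
  cbv beta in E; replace (t + h - t) with h in E by ring.
  assert (Hpos : 0 <= lsum (fun x => c x * cos (u x * y + p x)) L) by (apply HG; lra).
  apply Rmult_le_reg_l with h; [exact Hh|]; rewrite Rmult_0_r, <- lsum_scal.
  apply Rle_trans with (lsum (fun x => P x (t + h)) L - lsum (fun x => P x t) L).
  { rewrite E; apply Rmult_le_pos; lra. }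
  right; unfold Rminus.
  replace (- lsum (fun x => P x t) L) with (-1 * lsum (fun x => P x t) L) by ring.
  rewrite <- lsum_scal, <- lsum_plus; apply lsum_ext; intros x Hx.
  unfold P, sinc_factor; destruct (Req_EM_T (u x) 0) as [E0|E0].
  + rewrite (Hp x Hx E0), E0; replace (0 * t + (0 + 0 * h / 2)) with 0 by field; rewrite cos_0; ring.
  + set (A := u x * t + (p x + u x * h / 2)); set (D := u x * h / 2).
    replace (u x * (t + h) + p x) with (A + D) by (unfold A, D; field).
    replace (u x * t + p x) with (A - D) by (unfold A, D; field).
    rewrite sin_plus, sin_minus; field; lra.
Qed.

Lemma sinc_factor_bound h v d : 0 < h -> 0 < d -> d <= Rabs v -> Rabs (sinc_factor h v) <= 2 / (d * h).
Proof.
intros Hh Hd Hv; unfold sinc_factor; destruct (Req_EM_T v 0) as [E|E].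
- rewrite E, Rabs_R0 in Hv; lra.
- unfold Rdiv; rewrite !Rabs_mult, Rabs_inv, Rabs_mult, (Rabs_pos_eq 2), (Rabs_pos_eq h) by lra.
  assert (Hs : Rabs (sin (v * h * / 2)) <= 1) by (apply Rabs_le, SIN_bound).
  pose proof (Rabs_pos (sin (v * h * / 2))).
  apply Rmult_le_compat; [lra| |lra|].
  + left; apply Rinv_0_lt_compat, Rmult_lt_0_compat; lra.
  + apply Rinv_le_contravar; [apply Rmult_lt_0_compat; lra|apply Rmult_le_compat_r; lra].
Qed.

(** Averaging [k] times divides the amplitude at a frequency [v <> 0] by at least
    [(|v| h / 2) ^ k] and does not touch the constant terms, so that a cosine sum which is
    nonnegative on a long interval has an essentially nonnegative constant part. *)
Lemma cos_sum_positive {X : Type} (L : list X) (u : X -> R) h d k : 0 < h -> 0 < d ->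
  (forall x, In x L -> u x = 0 \/ d <= Rabs (u x)) ->
  forall (c p : X -> R) a, (forall x, In x L -> u x = 0 -> p x = 0) ->
  (forall t, a <= t <= a + INR k * h -> 0 <= lsum (fun x => c x * cos (u x * t + p x)) L) ->
  0 <= lsum (fun x => if Req_EM_T (u x) 0 then c x else (2 / (d * h)) ^ k * Rabs (c x)) L.
Proof.
intros Hh Hd Hu; induction k as [|k IH]; intros c p a Hp HG.
- eapply Rle_trans; [apply (HG a); simpl; lra|].
  apply lsum_le; intros x Hx; destruct (Req_EM_T (u x) 0) as [E|E].
  + rewrite (Hp x Hx E), E; replace (0 * a + 0) with 0 by ring; rewrite cos_0; lra.
  + simpl; rewrite Rmult_1_l.
    eapply Rle_trans; [apply Rle_abs|]; rewrite Rabs_mult.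
    assert (Rabs (cos (u x * a + p x)) <= 1) by (apply Rabs_le, COS_bound).
    pose proof (Rabs_pos (c x)); nra.
- assert (Hq : 0 < 2 / (d * h)) by (apply Rdiv_lt_0_compat; [lra|apply Rmult_lt_0_compat; lra]).
  eapply Rle_trans; [apply (IH (fun x => c x * sinc_factor h (u x)) (fun x => p x + u x * h / 2) a)|].
  + intros x Hx E; rewrite (Hp x Hx E), E; field.
  + apply cos_sum_average; [exact Hh|exact Hp|].
    intros t Ht; apply HG; rewrite S_INR; lra.
  + apply lsum_le; intros x Hx; unfold sinc_factor at 1.
    destruct (Req_EM_T (u x) 0) as [E|E]; [lra|].
    rewrite Rabs_mult; simpl.
    destruct (Hu x Hx) as [E'|Hdx]; [contradiction|].
    pose proof (sinc_factor_bound h (u x) d Hh Hd Hdx).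
    replace (2 / (d * h) * (2 / (d * h)) ^ k * Rabs (c x)) with ((2 / (d * h)) ^ k * (Rabs (c x) * (2 / (d * h)))) by ring.
    apply Rmult_le_compat_l; [apply pow_le; lra|].
    apply Rmult_le_compat_l; [apply Rabs_pos|assumption].
Qed.

(** * Sets of integers almost invariant under multiplication *)

(** All products of [J] integers of [[1, y]], one for each multiset: either the factor
    [S k] does not occur, or it can be removed.  Equal products may be repeated. *)
Fixpoint prods (y : nat) : nat -> list nat :=
  match y with
  | O => fun J => match J with O => 1%nat :: nil | S _ => nil end
  | S k => fix F J := match J with
                      | O => 1%nat :: nil
                      | S J' => prods k J ++ map (Nat.mul (S k)) (F J')
                      end
  end.

Lemma prods_S y J : prods (S y) (S J) = prods y (S J) ++ map (Nat.mul (S y)) (prods (S y) J).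
Proof. reflexivity. Qed.

Lemma prods_0 y : prods y 0 = 1%nat :: nil.
Proof. destruct y; reflexivity. Qed.

Lemma prods_mul y : forall J x n, (1 <= n <= y)%nat -> In x (prods y J) -> In (n * x)%nat (prods y (S J)).
Proof.
induction y as [|y IHy]; intros J x n Hn Hx; [lia|].
revert x Hx; induction J as [|J IHJ]; intros x Hx; rewrite prods_S; apply in_or_app;
  (destruct (Nat.eq_dec n (S y)) as [->|Hne]; [right; apply in_map; exact Hx|]).
- left; rewrite prods_0 in Hx; apply IHy; [lia|rewrite prods_0; exact Hx].
- rewrite prods_S in Hx; apply in_app_or in Hx; destruct Hx as [Hx|Hx].
  + left; apply IHy; [lia|exact Hx].
  + right; apply in_map_iff in Hx; destruct Hx as [x' [<- Hx']].
    replace (n * (S y * x'))%nat with (S y * (n * x'))%nat by ring.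
    apply in_map, IHJ, Hx'.
Qed.

Lemma prods_bounds y : forall J x, In x (prods y J) -> (1 <= x <= y ^ J)%nat.
Proof.
induction y as [|y IHy]; intros J x Hx.
- destruct J as [|J]; simpl in Hx; [destruct Hx as [<-|[]]; simpl; lia|contradiction].
- revert x Hx; induction J as [|J IHJ]; intros x Hx.
  + rewrite prods_0 in Hx; destruct Hx as [<-|[]]; simpl; lia.
  + rewrite prods_S in Hx; apply in_app_or in Hx; destruct Hx as [Hx|Hx].
    * pose proof (IHy _ _ Hx); pose proof (Nat.pow_le_mono_l y (S y) (S J)); lia.
    * apply in_map_iff in Hx; destruct Hx as [x' [<- Hx']].
      specialize (IHJ _ Hx'); rewrite Nat.pow_succ_r'.
      split; [nia|apply Nat.mul_le_mono_l; lia].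
Qed.

(** The generating function of the number of multisets is [(1 - z) ^ (- y)], and each of
    its coefficients is at most its value divided by [z ^ J]. *)
Lemma prods_length y J z : 0 < z < 1 -> INR (length (prods y J)) <= (/ z) ^ J * (/ (1 - z)) ^ y.
Proof.
intros Hz.
assert (H1 : 1 <= / z) by (rewrite <- Rinv_1; apply Rinv_le_contravar; lra).
assert (H2 : 1 <= / (1 - z)) by (rewrite <- Rinv_1; apply Rinv_le_contravar; lra).
revert J; induction y as [|y IHy]; intros J.
- simpl pow; pose proof (pow_R1_Rle (/ z) J H1).
  destruct J as [|J]; simpl length; simpl INR in *; lra.
- induction J as [|J IHJ].
  + rewrite prods_0; pose proof (pow_R1_Rle (/ (1 - z)) (S y) H2); simpl length; simpl INR; rewrite pow_O; lra.
  + rewrite prods_S, length_app, length_map, plus_INR.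
    eapply Rle_trans; [apply Rplus_le_compat; [apply IHy|apply IHJ]|].
    right; rewrite <- !tech_pow_Rmult; field; lra.
Qed.

Definition prod_set (y J : nat) : list nat := nodup Nat.eq_dec (prods y J).

(** If passing from [J] to [J + 1] enlarged the set by a factor [1 / (1 - eps)] for every
    [J < K y], the set would have at least [(1 - eps) ^ (- K y)] elements at [J = K y]; but
    the number of multisets is at most [(z ^ (- K) / (1 - z)) ^ y], which is smaller when
    [1 - eps < z < 1] and [K] is large. *)
Lemma prod_set_almost_invariant eps : 0 < eps < 1 -> exists K : nat, forall y, (1 <= y)%nat ->
  exists J, (J < K * y)%nat /\ (1 - eps) * INR (length (prod_set y (S J))) <= INR (length (prod_set y J)).
Proof.
intros He; set (q := 1 - eps).
(* Any [z] strictly between [q] and [1] would do. *)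
set (z := (1 + q) / 2).
assert (Hz : 0 < z < 1) by (unfold z, q; lra).
assert (Hr : 0 < q / z < 1).
{ split; [apply Rdiv_lt_0_compat; unfold q; lra|].
  apply Rmult_lt_reg_r with z; [lra|]; unfold Rdiv; rewrite Rmult_assoc, Rinv_l by lra.
  unfold z, q; lra. }
destruct (pow_lt_1_zero (q / z) ltac:(rewrite Rabs_pos_eq; lra) (1 - z) ltac:(lra)) as [K HK].
exists K; intros y Hy.
assert (HJ : forall J, (exists j, (j < J)%nat /\ q * INR (length (prod_set y (S j))) <= INR (length (prod_set y j)))
   \/ 1 <= q ^ J * INR (length (prod_set y J))).
{ induction J as [|J [[j [Hj H]]|IH]].
  - right; unfold prod_set; rewrite prods_0; simpl; lra.
  - left; exists j; split; [lia|exact H].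
  - destruct (Rle_dec (q * INR (length (prod_set y (S J)))) (INR (length (prod_set y J)))) as [H|H].
    + left; exists J; split; [lia|exact H].
    + right; eapply Rle_trans; [exact IH|].
      apply Rnot_le_lt in H; rewrite <- tech_pow_Rmult, (Rmult_comm q), Rmult_assoc.
      apply Rmult_le_compat_l; [apply pow_le; unfold q; lra|lra]. }
destruct (HJ (K * y)%nat) as [H|H]; [exact H|exfalso].
assert (HL : INR (length (prod_set y (K * y))) <= (/ z) ^ (K * y) * (/ (1 - z)) ^ y).
{ eapply Rle_trans; [apply le_INR|apply prods_length, Hz].
  apply NoDup_incl_length; [apply NoDup_nodup|intros x; apply nodup_In]. }
assert (Hq : 0 < q) by (unfold q; lra).
assert (H' : 1 <= ((q / z) ^ K * / (1 - z)) ^ y).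
{ eapply Rle_trans; [exact H|].
  eapply Rle_trans; [apply Rmult_le_compat_l; [apply pow_le; lra|exact HL]|].
  right; unfold Rdiv; rewrite <- Rmult_assoc, <- Rpow_mult_distr, pow_mult, <- Rpow_mult_distr; reflexivity. }
specialize (HK K (Nat.le_refl K)); rewrite Rabs_pos_eq in HK by (apply pow_le; lra).
assert (HX : 0 <= (q / z) ^ K * / (1 - z) < 1).
{ split; [apply Rmult_le_pos; [apply pow_le; lra|left; apply Rinv_0_lt_compat; lra]|].
  apply Rmult_lt_reg_r with (1 - z); [lra|]; rewrite Rmult_assoc, Rinv_l; lra. }
set (X := (q / z) ^ K * / (1 - z)) in *; clearbody X.
destruct y as [|y]; [lia|]; simpl in H'.
assert (X ^ y <= 1) by (rewrite <- (pow1 y); apply pow_incr; lra).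
pose proof (pow_le X y (proj1 HX)); nra.
Qed.

(** * The resonance inequality *)

(** The logarithms of [a] and [a + 1] differ by at least [1 / (a + 1)], and only the
    smaller of [p] and [q] plays the part of [a]. *)
Lemma log_gap p q M : (1 <= p)%nat -> (1 <= q)%nat -> (q <= M)%nat -> p <> q ->
  / INR (S M) <= Rabs (ln (INR p) - ln (INR q)).
Proof.
intros Hp Hq HM Hne.
assert (H : forall a b, (1 <= a)%nat -> (a < b)%nat -> (a <= M)%nat -> / INR (S M) <= ln (INR b) - ln (INR a)).
{ intros a b Ha Hab HaM.
  assert (1 <= INR a) by (apply (le_INR 1), Ha).
  assert (INR a + 1 <= INR b) by (rewrite <- S_INR; apply le_INR, Hab).
  pose proof (proj1 (ln_succ_bounds (INR a) ltac:(lra))).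
  pose proof (ln_le' (INR a + 1) (INR b) ltac:(lra) ltac:(lra)).
  assert (/ INR (S M) <= / (INR a + 1)).
  { rewrite <- S_INR; apply Rinv_le_contravar; [rewrite S_INR; lra|apply le_INR; lia]. }
  lra. }
destruct (Nat.lt_ge_cases p q) as [Hl|Hl].
- pose proof (H p q Hp Hl ltac:(lia)); rewrite Rabs_minus_sym; eapply Rle_trans; [eassumption|apply Rle_abs].
- pose proof (H q p Hq ltac:(lia) HM); eapply Rle_trans; [eassumption|apply Rle_abs].
Qed.

(** This is the real part of [exp (i a) |R|^2] with [R] the sum of the [exp (i f m)]. *)
Lemma cos_double_sum {X : Type} (B : list X) (f : X -> R) a :
  lsum (fun m => lsum (fun m' => cos (a + f m - f m')) B) B =
  cos a * (lsum (fun m => cos (f m)) B ^ 2 + lsum (fun m => sin (f m)) B ^ 2).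
Proof.
set (C := lsum (fun m => cos (f m)) B); set (S := lsum (fun m => sin (f m)) B).
transitivity (lsum (fun m => (cos a * C + sin a * S) * cos (f m) + (cos a * S - sin a * C) * sin (f m)) B).
- apply lsum_ext; intros m _.
  transitivity (lsum (fun m' => cos (a + f m) * cos (f m') + sin (a + f m) * sin (f m')) B).
  + apply lsum_ext; intros m' _; rewrite cos_minus; reflexivity.
  + rewrite lsum_plus, !lsum_scal; fold C S; rewrite cos_plus, sin_plus; ring.
- rewrite lsum_plus, !lsum_scal; fold C S; ring.
Qed.

Lemma lsum_indicator (B : list nat) x : NoDup B ->
  lsum (fun m => if Nat.eq_dec x m then 1 else 0) B = if in_dec Nat.eq_dec x B then 1 else 0.
Proof.
intros HB; induction HB as [|m B Hm HB IH]; [reflexivity|].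
unfold lsum in *; cbn [fold_right]; rewrite IH.
destruct (Nat.eq_dec x m) as [E|E]; destruct (in_dec Nat.eq_dec x B) as [H'|H'];
  destruct (in_dec Nat.eq_dec x (m :: B)) as [H|H]; simpl in H; try lra; exfalso.
- apply Hm; rewrite <- E; exact H'.
- apply H; left; symmetry; exact E.
- apply H; left; symmetry; exact E.
- apply H; right; exact H'.
- destruct H as [H|H]; [apply E; symmetry; exact H|exact (H' H)].
Qed.

(** The number of solutions of [n m = m'] in [B], the coefficient of [n ^ (it)] in
    [|R(t)|^2], where [R(t)] is the sum of the [m ^ (it)] over [B]. *)
Definition coincidences (B : list nat) (n : nat) : R :=
  lsum (fun m => lsum (fun m' => if Nat.eq_dec (n * m) m' then 1 else 0) B) B.

Lemma coincidences_nonneg B n : 0 <= coincidences B n.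
Proof.
apply lsum_nonneg; intros m _; apply lsum_nonneg; intros m' _; destruct (Nat.eq_dec _ _); lra.
Qed.

Lemma coincidences_1 B : NoDup B -> coincidences B 1 <= INR (length B).
Proof.
intros HB; rewrite <- (Rmult_1_l (INR _)), <- (lsum_const 1 B); apply lsum_le; intros m _.
rewrite lsum_indicator by exact HB; destruct (in_dec _ _ _); lra.
Qed.

Lemma coincidences_ge B B0 n : NoDup B -> NoDup B0 -> incl B0 B ->
  (forall m, In m B0 -> In (n * m)%nat B) -> INR (length B0) <= coincidences B n.
Proof.
intros HB HB0 Hi Hn.
apply Rle_trans with (lsum (fun m => if in_dec Nat.eq_dec m B0 then 1 else 0) B).
- rewrite <- (Rmult_1_l (INR _)), <- (lsum_const 1 B0).
  transitivity (lsum (fun m => lsum (fun m0 => if Nat.eq_dec m m0 then 1 else 0) B0) B); [|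
    right; apply lsum_ext; intros m _; apply lsum_indicator, HB0].
  rewrite lsum_exchange; apply lsum_le; intros m0 Hm0.
  transitivity (lsum (fun m => if Nat.eq_dec m0 m then 1 else 0) B).
  + rewrite lsum_indicator by exact HB; destruct (in_dec _ _ _) as [H|H]; [lra|].
    exfalso; apply H, Hi, Hm0.
  + right; apply lsum_ext; intros m _.
    destruct (Nat.eq_dec m0 m), (Nat.eq_dec m m0); congruence.
- apply lsum_le; intros m Hm; rewrite lsum_indicator by exact HB.
  destruct (in_dec Nat.eq_dec m B0) as [H|H]; destruct (in_dec _ _ _) as [H'|H']; try lra.
  exfalso; apply H', Hn, H.
Qed.

Lemma log_weight_nonneg l n : 0 <= ln (INR n) ^ l / INR n.
Proof.
destruct n as [|n]; [simpl; unfold Rdiv; rewrite Rinv_0; lra|].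
pose proof (INR_S_ge1 n); pose proof (ln_ge_0 (INR (S n)) ltac:(lra)).
apply Rdiv_le_0_compat; [apply pow_le; lra|lra].
Qed.

(** If [logsum l N <= V] on [[T, 2T]], then [(V - logsum l N t) |R(t)|^2] is a nonnegative
    cosine sum with frequencies [ln (n m / m')].  Its constant part consists of the terms
    with [n m = m'], and the other frequencies are at least [1 / (M + 1)], so averaging
    bounds [V] from below.  As all weights are nonnegative, the [n] beyond [y] can be
    dropped from the constant part. *)
Lemma resonance (B B0 : list nat) l y N M k T V :
  NoDup B -> NoDup B0 -> incl B0 B -> (forall m, In m B -> (1 <= m <= M)%nat) ->
  (forall n m, (1 <= n <= y)%nat -> In m B0 -> In (n * m)%nat B) -> (y <= N)%nat -> (1 <= k)%nat ->
  0 < T -> (forall t, T <= t <= 2 * T -> logsum l N t <= V) ->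
  let eta := (2 * INR k * INR (S M) / T) ^ k in
  let weight n := ln (INR n) ^ l / INR n in
  lsum weight (seq 1 y) * INR (length B0) <=
  V * INR (length B) + eta * (Rabs V + lsum weight (seq 1 N)) * INR (length B) ^ 2.
Proof.
intros HB HB0 Hi HM Hmul HyN Hk HT HV eta weight.
(* The constant [V] is treated as one more term, with [n = 1]. *)
set (I := (V, 1%nat) :: map (fun n => (- weight n, n)) (seq 1 N)).
set (L := list_prod I (list_prod B B)).
set (u := fun x : (R * nat) * (nat * nat) =>
  ln (INR (snd (fst x))) + ln (INR (fst (snd x))) - ln (INR (snd (snd x)))).
set (c := fun x : (R * nat) * (nat * nat) => fst (fst x)).
assert (Hk' : 1 <= INR k) by (apply (le_INR 1), Hk).
assert (HI : forall i, In i I -> (1 <= snd i)%nat).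
{ intros i [<-|Hi']; [simpl; lia|].
  apply in_map_iff in Hi'; destruct Hi' as [n [<- Hn]]; apply in_seq in Hn; simpl; lia. }
assert (HL : forall x, In x L -> (1 <= snd (fst x))%nat /\ (1 <= fst (snd x) <= M)%nat /\ (1 <= snd (snd x) <= M)%nat).
{ intros [i [m m']] Hx; apply in_prod_iff in Hx; destruct Hx as [Hx1 Hx2].
  apply in_prod_iff in Hx2; destruct Hx2; repeat split; simpl; try apply HI; try apply HM; assumption. }
assert (Hu : forall x, In x L -> u x = ln (INR (snd (fst x) * fst (snd x))) - ln (INR (snd (snd x)))).
{ intros x Hx; destruct (HL x Hx) as (H1 & H2 & H3); unfold u.
  rewrite mult_INR, ln_mult; [reflexivity|apply lt_0_INR; lia|apply lt_0_INR; lia]. }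
assert (Hgap : forall x, In x L -> u x = 0 \/ / INR (S M) <= Rabs (u x)).
{ intros x Hx; rewrite (Hu x Hx); destruct (HL x Hx) as (H1 & H2 & H3).
  destruct (Nat.eq_dec (snd (fst x) * fst (snd x)) (snd (snd x))) as [E|E].
  - left; rewrite E; ring.
  - right; apply log_gap; [nia|lia|lia|exact E]. }
pose proof (INR_S_ge1 M) as HM1.
assert (Hd : 0 < / INR (S M)) by (apply Rinv_0_lt_compat; lra).
assert (Hh : 0 < T / INR k) by (apply Rdiv_lt_0_compat; lra).
pose proof (cos_sum_positive L u (T / INR k) (/ INR (S M)) k Hh Hd Hgap c (fun _ => 0) T
  (fun _ _ _ => eq_refl)) as Q.
replace (2 / (/ INR (S M) * (T / INR k))) with (2 * INR k * INR (S M) / T) in Q by (field; lra).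
fold eta in Q.
assert (Heta : 0 <= eta).
{ apply pow_le, Rdiv_le_0_compat; [|exact HT]; apply Rmult_le_pos; lra. }
match type of Q with ?A -> ?B => assert (HQ : A) end.
{ intros t Ht; replace (T + INR k * (T / INR k)) with (2 * T) in Ht by (field; lra).
  unfold L; rewrite lsum_list_prod.
  transitivity (lsum (fun i : R * nat => (lsum (fun m => cos (t * ln (INR m))) B ^ 2 +
     lsum (fun m => sin (t * ln (INR m))) B ^ 2) * (fst i * cos (t * ln (INR (snd i))))) I).
  - rewrite lsum_scal; apply Rmult_le_pos.
    { apply Rplus_le_le_0_compat; apply pow2_ge_0. }
    unfold I; cbn [lsum fold_right fst snd].
    fold (lsum (fun i : R * nat => fst i * cos (t * ln (INR (snd i))))
      (map (fun n => (- weight n, n)) (seq 1 N))).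
    rewrite lsum_map; cbn [fst snd]; change (INR 1) with 1; rewrite ln_1, Rmult_0_r, cos_0, Rmult_1_r.
    replace (lsum _ (seq 1 N)) with (- logsum l N t); [specialize (HV t Ht); lra|].
    unfold logsum;
    replace (- lsum (fun n => ln (INR n) ^ l / INR n * cos (t * ln (INR n))) (seq 1 N))
      with (-1 * lsum (fun n => ln (INR n) ^ l / INR n * cos (t * ln (INR n))) (seq 1 N)) by ring.
    rewrite <- lsum_scal; apply lsum_ext; intros n _; unfold weight; ring.
  - right; apply lsum_ext; intros [v n] _; rewrite lsum_list_prod; cbn [fst snd].
    rewrite (Rmult_comm _ (v * _)), Rmult_assoc.
    rewrite <- (cos_double_sum B (fun m => t * ln (INR m)) (t * ln (INR n))), <- lsum_scal.
    apply lsum_ext; intros m _; rewrite <- lsum_scal; apply lsum_ext; intros m' _.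
    unfold c, u; cbn [fst snd]; do 2 f_equal; ring. }
specialize (Q HQ); clear HQ.
assert (Hup : 0 <= lsum (fun i : R * nat => fst i * coincidences B (snd i)
   + eta * Rabs (fst i) * INR (length B) ^ 2) I).
{ eapply Rle_trans; [exact Q|].
  eapply Rle_trans; [apply (lsum_le _ (fun x => c x * (if Nat.eq_dec (snd (fst x) * fst (snd x)) (snd (snd x)) then 1 else 0)
    + eta * Rabs (c x)))|].
  - intros x Hx.
    assert (H0 : 0 <= eta * Rabs (c x)) by (apply Rmult_le_pos; [exact Heta|apply Rabs_pos]).
    destruct (Req_EM_T (u x) 0) as [E|E]; destruct (Nat.eq_dec _ _) as [E'|E']; try lra.
    + exfalso; destruct (HL x Hx) as (H1 & H2 & H3).
      pose proof (log_gap (snd (fst x) * fst (snd x)) (snd (snd x)) M ltac:(nia) ltac:(lia) ltac:(lia) E') as G.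
      rewrite <- (Hu x Hx), E, Rabs_R0 in G; lra.
    + exfalso; apply E; rewrite (Hu x Hx), E'; ring.
  - unfold L; rewrite lsum_list_prod; right; apply lsum_ext; intros [v n] _.
    rewrite lsum_list_prod; unfold coincidences, c; cbn [fst snd].
    rewrite <- lsum_scal.
    replace (eta * Rabs v * INR (length B) ^ 2) with (eta * Rabs v * INR (length B) * INR (length B)) by ring.
    rewrite <- (lsum_const (eta * Rabs v * INR (length B)) B), <- lsum_plus.
    apply lsum_ext; intros m _.
    rewrite <- lsum_scal, <- (lsum_const (eta * Rabs v) B), <- lsum_plus; reflexivity. }
unfold I in Hup; cbn [lsum fold_right fst snd] in Hup.
match type of Hup with context [fold_right ?f 0 (map ?g ?s)] =>
  change (fold_right f 0 (map g s)) with
   (lsum (fun i : R * nat => fst i * coincidences B (snd i) + eta * Rabs (fst i) * INR (length B) ^ 2) (map g s)) in Hup end.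
rewrite lsum_map in Hup; cbn [fst snd] in Hup.
assert (Hw : forall n, 0 <= weight n) by (intros n; apply log_weight_nonneg).
assert (HN : lsum (fun n => - weight n * coincidences B n + eta * Rabs (- weight n) * INR (length B) ^ 2) (seq 1 N)
  = - lsum (fun n => weight n * coincidences B n) (seq 1 N) + eta * lsum weight (seq 1 N) * INR (length B) ^ 2).
{ replace (- lsum (fun n => weight n * coincidences B n) (seq 1 N))
    with (-1 * lsum (fun n => weight n * coincidences B n) (seq 1 N)) by ring.
  replace (eta * lsum weight (seq 1 N) * INR (length B) ^ 2)
    with (eta * INR (length B) ^ 2 * lsum weight (seq 1 N)) by ring.
  rewrite <- !lsum_scal, <- lsum_plus; apply lsum_ext; intros n _.
  rewrite Rabs_Ropp, Rabs_pos_eq by apply Hw; ring. }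
rewrite HN in Hup; clear HN.
assert (HD : lsum weight (seq 1 y) * INR (length B0) <= lsum (fun n => weight n * coincidences B n) (seq 1 N)).
{ replace (seq 1 N) with (seq 1 y ++ seq (1 + y) (N - y)) by (rewrite <- seq_app; f_equal; lia).
  rewrite lsum_app, Rmult_comm, <- lsum_scal.
  rewrite <- (Rplus_0_r (lsum _ (seq 1 y))); apply Rplus_le_compat.
  - apply lsum_le; intros n Hn; apply in_seq in Hn; rewrite Rmult_comm.
    apply Rmult_le_compat_l; [apply Hw|].
    apply coincidences_ge; try assumption; intros m Hm; apply Hmul; [lia|exact Hm].
  - apply lsum_nonneg; intros n _; apply Rmult_le_pos; [apply Hw|apply coincidences_nonneg]. }
assert (H1 : V * coincidences B 1 = V * INR (length B)).
{ f_equal; apply Rle_antisym; [apply coincidences_1, HB|].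
  apply coincidences_ge; try assumption; [apply incl_refl|intros m Hm; rewrite Nat.mul_1_l; exact Hm]. }
rewrite H1 in Hup; lra.
Qed.

(** * The two sides compared *)

(** The bound [(1 - x / 128) ^ 128 <= exp (- x)] for [x = 761 / 280], the eighth harmonic
    number, compared with a decimal fraction by exact integer arithmetic. *)
Lemma exp_neg_harmonic_8_lower : 100 / 1576 <= exp (- (761 / 280)).
Proof.
assert (HPQ : (100 * 35840 ^ 128 <= 1576 * 35079 ^ 128)%Z) by (vm_compute; discriminate).
apply IZR_le in HPQ; rewrite !mult_IZR in HPQ.
change (35840 ^ 128)%Z with (35840 ^ Z.of_nat 128)%Z in HPQ.
change (35079 ^ 128)%Z with (35079 ^ Z.of_nat 128)%Z in HPQ.
rewrite <- !pow_IZR in HPQ.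
assert (HE : exp (- (761 / 280)) = exp (- (761 / 35840)) ^ 128).
{ rewrite <- Rpower_pow by apply exp_pos; unfold Rpower; rewrite ln_exp; f_equal.
  rewrite INR_IZR_INZ; simpl Z.of_nat; field. }
assert (H1 : 35079 / 35840 <= exp (- (761 / 35840))).
{ pose proof (exp_ineq1_le (- (761 / 35840))); lra. }
rewrite HE; apply Rle_trans with ((35079 / 35840) ^ 128); [|apply pow_incr; lra].
clear HE H1; unfold Rdiv; rewrite (Rpow_mult_distr 35079), pow_inv.
assert (HQ : 0 < 35840 ^ 128) by (apply pow_lt; lra).
revert HQ HPQ; generalize (35840 ^ 128) (35079 ^ 128); intros q p HQ HPQ.
apply Rmult_le_reg_r with (1576 * q); [lra|].
replace (100 * / 1576 * (1576 * q)) with (100 * q) by field.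
replace (p * / q * (1576 * q)) with (1576 * p) by (field; lra); exact HPQ.
Qed.

(** The sequence defining [euler_gamma] decreases, and its eighth term is already below
    [ln 1.97]; any bound below [ln 2] would serve. *)
Lemma exp_euler_gamma_bound : exp euler_gamma <= 197 / 100.
Proof.
assert (H : euler_gamma <= 761 / 280 - ln 8).
{ replace (761 / 280 - ln 8) with (sum_n (fun k => / INR (S k)) 7 - ln (INR 8)).
  - apply (is_lim_seq_decr_compare (fun n => sum_n (fun k => / INR (S k)) n - ln (INR (S n)))).
    + apply is_lim_euler_gamma.
    + intros n; rewrite sum_Sn; change (@plus R_AbelianMonoid) with Rplus.
      rewrite (S_INR (S n)); pose proof (INR_S_ge1 n).
      pose proof (ln_succ_bounds (INR (S n)) ltac:(lra)); lra.
  - rewrite !sum_Sn, sum_O; change (@plus R_AbelianMonoid) with Rplus.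
    replace (INR 8) with 8 by (simpl; ring); simpl; field. }
apply Rle_trans with (exp (761 / 280 - ln 8)); [apply exp_le, H|].
unfold Rminus; rewrite exp_plus, exp_Ropp, exp_ln by lra.
pose proof exp_neg_harmonic_8_lower as H2.
assert (H3 : exp (761 / 280) * exp (- (761 / 280)) = 1) by (rewrite <- exp_plus, Rplus_opp_r; apply exp_0).
pose proof (exp_pos (761 / 280)); nra.
Qed.

Lemma pow_diff_le a b k : 0 <= a <= b -> b ^ S k - a ^ S k <= INR (S k) * b ^ k * (b - a).
Proof.
intros H; induction k as [|k IH]; [simpl; lra|].
replace (b ^ S (S k) - a ^ S (S k)) with (b * (b ^ S k - a ^ S k) + a ^ S k * (b - a)) by (simpl; ring).
assert (a ^ S k <= b ^ S k) by (apply pow_incr; exact H).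
rewrite (S_INR (S k)).
apply Rle_trans with (b * (INR (S k) * b ^ k * (b - a)) + b ^ S k * (b - a)); [|right; simpl; ring].
apply Rplus_le_compat; [apply Rmult_le_compat_l; lra|apply Rmult_le_compat_r; lra].
Qed.

(** The sum telescopes against [(ln n) ^ (l + 1)].  The loss of [1 / n] versus
    [1 / (n + 1)] is a factor [1 - 1 / n0] if one starts at [n0]; this avoids discussing
    where [(ln x) ^ l / x] increases. *)
Lemma log_weight_sum_ge l n0 y : (1 <= n0 <= y)%nat ->
  (1 - / INR n0) * (ln (INR y) ^ S l - ln (INR n0) ^ S l)
  <= INR (S l) * lsum (fun n => ln (INR n) ^ l / INR n) (seq 1 y).
Proof.
intros [Hn Hy]; induction Hy as [|y Hy IH].
- rewrite Rminus_diag, Rmult_0_r; apply Rmult_le_pos; [apply pos_INR|].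
  apply lsum_nonneg; intros; apply log_weight_nonneg.
- rewrite seq_S, lsum_app; cbn [lsum fold_right Nat.add].
  rewrite Rmult_plus_distr_l, Rplus_0_r.
  assert (H1 : 1 <= INR n0) by (apply (le_INR 1), Hn).
  assert (H2 : INR n0 <= INR y) by (apply le_INR, Hy).
  rewrite (S_INR y).
  pose proof (ln_ge_0 (INR y) ltac:(lra)) as HL.
  pose proof (ln_le' (INR y) (INR y + 1) ltac:(lra) ltac:(lra)) as HL'.
  pose proof (pow_diff_le (ln (INR y)) (ln (INR y + 1)) l ltac:(lra)) as Q.
  pose proof (proj2 (ln_succ_bounds (INR y) ltac:(lra))) as Q2.
  assert (HP : 0 <= ln (INR y + 1) ^ l) by (apply pow_le; lra).
  pose proof (pos_INR (S l)) as HS.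
  assert (Hc : 0 <= 1 - / INR n0 <= INR y / (INR y + 1)).
  { split.
    - assert (/ INR n0 <= 1) by (rewrite <- Rinv_1; apply Rinv_le_contravar; lra); lra.
    - replace (INR y / (INR y + 1)) with (1 - / (INR y + 1)) by (field; lra).
      destruct (Rle_lt_dec (INR y + 1) (INR n0)) as [H|H]; [lra|].
      pose proof (Rinv_le_contravar (INR n0) (INR y + 1) ltac:(lra) ltac:(lra)); lra. }
  assert (Q3 : (1 - / INR n0) * (ln (INR y + 1) ^ S l - ln (INR y) ^ S l)
    <= INR (S l) * (ln (INR y + 1) ^ l / (INR y + 1))).
  { apply Rle_trans with (INR y / (INR y + 1) * (INR (S l) * ln (INR y + 1) ^ l * / INR y)).
    - apply Rmult_le_compat; [lra| |lra|].
      + pose proof (pow_incr (ln (INR y)) (ln (INR y + 1)) (S l) ltac:(lra)); lra.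
      + eapply Rle_trans; [exact Q|]; apply Rmult_le_compat_l; [apply Rmult_le_pos; lra|exact Q2].
    - right; field; lra. }
  lra.
Qed.

(** By Bernoulli [(1 + 1/l)^l >= 2], so that the constant of the theorem is at most
    [exp euler_gamma / 2] over [l + 1], a fixed factor below [1 / (l + 1)]. *)
Lemma target_constant_le l Z : (1 <= l)%nat -> 0 <= Z ->
  exp euler_gamma * INR l ^ l * / (INR (l + 1) ^ (l + 1)) * Z ^ (l + 1)
  <= 985 / 1000 * (Z ^ S l / INR (S l)).
Proof.
intros Hl HZ; rewrite Nat.add_1_r.
assert (Hl1 : 1 <= INR l) by (apply (le_INR 1), Hl).
assert (HP : 0 < INR l ^ l) by (apply pow_lt; lra).
assert (HS : 0 < INR (S l)) by (rewrite S_INR; lra).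
assert (HB : 2 * INR l ^ l <= INR (S l) ^ l).
{ rewrite S_INR; replace (INR l + 1) with ((1 + / INR l) * INR l) by (field; lra).
  rewrite Rpow_mult_distr; apply Rmult_le_compat_r; [lra|].
  pose proof (poly l (/ INR l) ltac:(apply Rinv_0_lt_compat; lra)) as Q.
  rewrite Rinv_r in Q; lra. }
assert (HX : 0 < INR (S l) ^ l) by (apply pow_lt, HS).
assert (HZ' : 0 <= Z ^ S l / INR (S l)).
{ apply Rdiv_le_0_compat; [apply pow_le, HZ|exact HS]. }
replace (exp euler_gamma * INR l ^ l * / INR (S l) ^ S l * Z ^ S l)
  with (exp euler_gamma * (INR l ^ l / INR (S l) ^ l) * (Z ^ S l / INR (S l))).
2:{ rewrite <- (tech_pow_Rmult (INR (S l)) l); field; split; lra. }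
apply Rmult_le_compat_r; [exact HZ'|].
assert (HH : 0 <= INR l ^ l / INR (S l) ^ l <= 1 / 2).
{ split; [apply Rdiv_le_0_compat; lra|].
  apply Rmult_le_reg_r with (INR (S l) ^ l); [exact HX|].
  unfold Rdiv at 1; rewrite Rmult_assoc, Rinv_l, Rmult_1_r by lra; lra. }
replace (985 / 1000) with (197 / 100 * (1 / 2)) by field.
apply Rmult_le_compat; [left; apply exp_pos|apply HH|apply exp_euler_gamma_bound|apply HH].
Qed.

Lemma ln_le_half w : 0 < w -> ln w <= w / 2.
Proof.
intros Hw; rewrite <- (ln_exp (w / 2)); apply ln_le'; [exact Hw|].
replace (w / 2) with (w / 4 + w / 4) by field; rewrite exp_plus.
pose proof (exp_ineq1_le (w / 4)) as Q.
apply Rle_trans with ((1 + w / 4) * (1 + w / 4)); [|apply Rmult_le_compat; lra].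
pose proof (pow2_ge_0 (1 - w / 4)); lra.
Qed.

(** The length [y] of the range to be controlled is [ln T / (4 K ln ln T)]: it makes
    [y ^ (K y)] at most [T ^ (1/4)], and [ln y >= ln ln T - ln ln ln T - ln (8 K)]. *)
Lemma resonance_length_exists (K : nat) : (1 <= K)%nat -> exists T0, forall T, T0 <= T ->
  let x := ln T in let Z := ln x - ln (ln x) - ln (8 * INR K) in
  exp (exp 1) <= T /\ 13100 <= Z /\ 4000 <= x /\
  exists y : nat, (1 <= y)%nat /\ Z <= ln (INR y) /\ INR y <= x /\ INR K * INR y * ln (INR y) <= x / 4.
Proof.
intros HK; set (A := ln (8 * INR K)).
assert (HK1 : 1 <= INR K) by (apply (le_INR 1), HK).
assert (HA : 0 <= A) by (apply ln_ge_0; lra).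
set (W := 2 * (13100 + A)).
exists (exp (exp W)); intros T HT x Z.
assert (HT0 : 0 < T) by (pose proof (exp_pos (exp W)); lra).
assert (Hx : exp W <= x).
{ rewrite <- (ln_exp (exp W)); apply ln_le'; [apply exp_pos|exact HT]. }
assert (Hw : W <= ln x).
{ rewrite <- (ln_exp W); apply ln_le'; [apply exp_pos|exact Hx]. }
pose proof (exp_ineq1_le W) as HW.
set (w := ln x) in *.
assert (HW0 : 26200 <= W) by (unfold W; lra).
pose proof (ln_le_half w ltac:(lra)) as Hlnw.
assert (HZ : 13100 <= Z) by (unfold Z; fold A; unfold W in Hw; lra).
split; [|split; [exact HZ|split; [lra|]]].
{ eapply Rle_trans; [|exact HT]; apply exp_le, exp_le; lra. }
assert (Hx0 : 0 < x) by lra.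
assert (Hw0 : 1 <= w) by lra.
assert (HV : x / (4 * INR K * w) = 2 * exp Z).
{ unfold Z; fold A; unfold Rminus; rewrite !exp_plus, !exp_Ropp.
  unfold A, w; rewrite !exp_ln; try lra; [field|fold w; lra].
  fold w; split; lra. }
assert (HeZ : 1 <= exp Z) by (pose proof (exp_ineq1_le Z); lra).
destruct (nfloor_ex (x / (4 * INR K * w)) ltac:(lra)) as [y [Hy1 Hy2]].
exists y.
assert (HyZ : exp Z <= INR y) by lra.
assert (HVx : INR K * w * INR y <= x / 4).
{ apply Rle_trans with (INR K * w * (x / (4 * INR K * w))).
  - apply Rmult_le_compat_l; [apply Rmult_le_pos; lra|exact Hy1].
  - right; field; lra. }
assert (Hyx : INR y <= x).
{ assert (1 * INR y <= INR K * w * INR y); [|lra].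
  apply Rmult_le_compat_r; [lra|]; nra. }
pose proof (ln_le' (INR y) x ltac:(lra) Hyx) as Hlny; fold w in Hlny.
split; [apply INR_le; simpl; lra|split; [|split; [exact Hyx|]]].
- rewrite <- (ln_exp Z); apply ln_le'; [apply exp_pos|exact HyZ].
- eapply Rle_trans; [|exact HVx].
  rewrite (Rmult_assoc (INR K) w), (Rmult_comm w), <- Rmult_assoc.
  apply Rmult_le_compat_l; [apply Rmult_le_pos; lra|exact Hlny].
Qed.

Lemma log_weight_sum_le l N : (1 <= N)%nat ->
  lsum (fun n => ln (INR n) ^ l / INR n) (seq 1 N) <= INR N * ln (INR N) ^ l.
Proof.
intros HN.
apply Rle_trans with (lsum (fun _ => ln (INR N) ^ l) (seq 1 N)).
- apply lsum_le; intros n Hn; apply in_seq in Hn.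
  assert (H1 : 1 <= INR n) by (apply (le_INR 1); lia).
  pose proof (ln_ge_0 (INR n) H1).
  pose proof (ln_le' (INR n) (INR N) ltac:(lra) ltac:(apply le_INR; lia)).
  apply Rle_trans with (ln (INR n) ^ l * 1); [|rewrite Rmult_1_r; apply pow_incr; lra].
  apply Rmult_le_compat_l; [apply pow_le; lra|].
  rewrite <- Rinv_1; apply Rinv_le_contravar; lra.
- rewrite lsum_const, length_seq; right; ring.
Qed.

(** The resonance inequality divided by [b], the cardinality of the resonating set.
    The numerical margin between [0.985] and [0.999 ^ 3 / 1.001] pays for the error [6 ^ l],
    since [(l + 1) 6 ^ l <= 12 ^ l] is below a small multiple of [Z ^ (l + 1)]. *)
Lemma lower_bound_of_resonance (l : nat) (M S0 AN b b0 eta L Z : R) :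
  (1 <= l)%nat -> 0 <= M -> 1 <= b -> 999 / 1000 * b <= b0 -> 0 <= eta ->
  eta * b <= / 1000 -> eta * b * AN <= 5 ^ l ->
  13100 <= Z -> Z <= L -> 0 <= S0 ->
  999 / 1000 * (L ^ S l - 10 ^ S l) <= INR (S l) * S0 ->
  S0 * b0 <= (M + 130 * 6 ^ l) * b + eta * ((M + 130 * 6 ^ l) + AN) * b ^ 2 ->
  985 / 1000 * (Z ^ S l / INR (S l)) <= M.
Proof.
intros Hl HM Hb Hb0 Heta H1 H2 HZ HL HS HS0 Hres.
set (V := M + 130 * 6 ^ l) in *.
assert (H6 : 1 <= 6 ^ l) by (apply pow_R1_Rle; lra).
assert (H5 : 5 ^ l <= 6 ^ l) by (apply pow_incr; lra).
assert (HV : 0 <= V) by (unfold V; lra).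
assert (HSl : 0 < INR (S l)) by (pose proof (INR_S_ge1 l); lra).
assert (R1 : 999 / 1000 * S0 <= V * (1 + / 1000) + 6 ^ l).
{ apply Rmult_le_reg_r with b; [lra|].
  apply Rle_trans with (S0 * b0).
  - replace (999 / 1000 * S0 * b) with (S0 * (999 / 1000 * b)) by ring.
    apply Rmult_le_compat_l; assumption.
  - eapply Rle_trans; [exact Hres|].
    replace (V * b + eta * (V + AN) * b ^ 2) with ((V * (1 + eta * b) + eta * b * AN) * b) by ring.
    apply Rmult_le_compat_r; [lra|].
    apply Rplus_le_compat; [apply Rmult_le_compat_l; lra|lra]. }
assert (HP10 : 10 ^ S l <= / 1000 * L ^ S l).
{ replace 10 with (/ 1310 * 13100) by field; rewrite Rpow_mult_distr.
  apply Rmult_le_compat; [apply pow_le; lra|apply pow_le; lra| |apply pow_incr; lra].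
  rewrite pow_inv; apply Rinv_le_contravar; [lra|].
  pose proof (pow_R1_Rle 1310 l ltac:(lra)); simpl; lra. }
assert (HZL : Z ^ S l <= L ^ S l) by (apply pow_incr; lra).
assert (HZ0 : 0 <= Z ^ S l) by (apply pow_le; lra).
assert (H2l : INR (S l) <= 2 ^ l).
{ rewrite S_INR; pose proof (poly l 1 ltac:(lra)) as Q; replace (1 + 1) with 2 in Q by ring; lra. }
assert (H12 : INR (S l) * 6 ^ l <= / 13100 * Z ^ S l).
{ apply Rle_trans with (2 ^ l * 6 ^ l); [apply Rmult_le_compat_r; lra|].
  rewrite <- Rpow_mult_distr; replace (2 * 6) with 12 by ring.
  apply Rle_trans with (Z ^ l); [apply pow_incr; lra|].
  simpl; pose proof (pow_le Z l ltac:(lra)); nra. }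
unfold Rdiv at 2; apply Rmult_le_reg_r with (INR (S l)); [exact HSl|].
replace (985 / 1000 * (Z ^ S l * / INR (S l)) * INR (S l)) with (985 / 1000 * Z ^ S l) by (field; lra).
unfold V in R1.
apply (Rmult_le_compat_l (INR (S l))) in R1; [|lra].
assert (HMS : 0 <= M * INR (S l)) by (apply Rmult_le_pos; lra).
set (P := Z ^ S l) in *; set (Q := L ^ S l) in *; set (s := INR (S l)) in *; set (e := 6 ^ l) in *.
clearbody P Q s e.
assert (R2 : 999 / 1000 * (s * S0) <= (M * s + 130 * (s * e)) * (1001 / 1000) + s * e) by lra.
lra.
Qed.

Theorem theorem1 :
  exists A T0 : R, forall T : R, T0 <= T ->
  forall l : nat, (1 <= l)%nat -> INR l <= ln T / ln (ln T) ->
  exists E M : R,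
    Rabs E <= A /\
    is_max_on (fun t => Cmod (C_derive_n zeta l (1, t))) T (2 * T) M /\
    M >= exp euler_gamma * INR l ^ l * / (INR (l + 1) ^ (l + 1))
         * (ln (ln T) - ln (ln (ln T)) + E) ^ (l + 1).
Proof.
destruct (prod_set_almost_invariant (/ 1000) ltac:(lra)) as [K HK].
assert (HK1 : (1 <= K)%nat).
{ destruct (HK 1%nat ltac:(lia)) as [J [HJ _]]; lia. }
destruct (resonance_length_exists K HK1) as [T0 HT0].
(* [E] is the constant [- ln (8 K)]. *)
exists (Rabs (- ln (8 * INR K))), T0; intros T HT l Hl HlT.
destruct (HT0 T HT) as (HTe & HZ & Hx & y & Hy1 & HZy & Hyx & HKy).
set (x := ln T) in *.
set (Z := ln x - ln (ln x) - ln (8 * INR K)) in *.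
assert (HTpos : 4001 <= T).
{ pose proof (exp_ineq1_le x) as Q; unfold x in Q at 2; rewrite exp_ln in Q; [lra|].
  pose proof (exp_pos (exp 1)); lra. }
destruct (zeta_derive_is_max l T (2 * T) ltac:(lra) ltac:(lra)) as [M HM].
exists (- ln (8 * INR K)), M; split; [lra|split; [exact HM|]].
fold x; apply Rle_ge.
replace (ln x - ln (ln x) + - ln (8 * INR K)) with Z by (unfold Z; ring).
eapply Rle_trans; [apply target_constant_le; [exact Hl|lra]|].
assert (HM0 : 0 <= M).
{ destruct HM as [[t [_ <-]] _]; apply Cmod_ge_0. }
destruct (nfloor_ex (T ^ 4) ltac:(apply pow_le; lra)) as [N [HN1 HN2]].
destruct (HK y Hy1) as [J [HJ HKJ]].
set (B := prod_set y (S J)) in *; set (B0 := prod_set y J) in *.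
assert (HT45 : T ^ 4 + 3 <= T ^ 5).
{ pose proof (pow_R1_Rle T 4 ltac:(lra)); replace (T ^ 5) with (T * T ^ 4) by ring; nra. }
assert (HS : forall t, T <= t <= 2 * T -> logsum l (S (S N)) t <= M + 130 * 6 ^ l).
{ intros t Ht; eapply Rle_trans; [apply (logsum_le_derive l T t N); try assumption|].
  - rewrite !S_INR; lra.
  - rewrite !S_INR; lra.
  - apply Rplus_le_compat_r, (proj2 HM), Ht. }
assert (HyN : (y <= S (S N))%nat).
{ apply INR_le; rewrite !S_INR.
  assert (x <= T).
  { pose proof (exp_ineq1_le x) as Q; unfold x in Q at 2; rewrite exp_ln in Q; lra. }
  pose proof (pow_R1_Rle T 3 ltac:(lra)); replace (T ^ 4) with (T * T ^ 3) in HN2 by ring; nra. }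
(* Thirteen averages save [tau ^ 26], against [tau] for the size of [B] and [tau ^ 24]
   for the sum of all weights. *)
pose proof (resonance B B0 l y (S (S N)) (y ^ S J) 13 T (M + 130 * 6 ^ l)) as Q.
(* All sizes are compared in powers of [tau = T ^ (1/4)]. *)
set (tau := exp (x / 4)).
assert (Htau : 1000 <= tau) by (pose proof (exp_ineq1_le (x / 4)); unfold tau; lra).
assert (HTtau : T = tau ^ 4).
{ unfold tau; rewrite <- Rpower_pow by apply exp_pos; unfold Rpower; rewrite ln_exp.
  replace (INR 4 * (x / 4)) with x by (simpl; field); unfold x; rewrite exp_ln; lra. }
assert (Hy0 : 1 <= INR y) by (apply (le_INR 1), Hy1).
assert (HMtau : INR (y ^ S J) <= tau).
{ rewrite pow_INR, <- Rpower_pow by lra; unfold Rpower, tau; apply exp_le.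
  eapply Rle_trans; [|exact HKy].
  apply Rmult_le_compat_r; [apply ln_ge_0, Hy0|].
  rewrite <- mult_INR; apply le_INR; lia. }
assert (HBM : forall m, In m B -> (1 <= m <= y ^ S J)%nat).
{ intros m Hm; apply (prods_bounds y (S J)), (nodup_In Nat.eq_dec), Hm. }
assert (HBlen : INR (length B) <= tau).
{ eapply Rle_trans; [apply le_INR|exact HMtau].
  rewrite <- (length_seq (y ^ S J) 1); apply NoDup_incl_length; [apply NoDup_nodup|].
  intros m Hm; apply in_seq; specialize (HBM m Hm); lia. }
assert (Hmul : forall n m, (1 <= n <= y)%nat -> In m B0 -> In (n * m)%nat B).
{ intros n m Hn Hm; apply nodup_In, prods_mul; [exact Hn|].
  apply (nodup_In Nat.eq_dec), Hm. }
assert (Hincl : incl B0 B).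
{ intros m Hm; rewrite <- (Nat.mul_1_l m); apply Hmul; [lia|exact Hm]. }
specialize (Q (NoDup_nodup _ _) (NoDup_nodup _ _) Hincl HBM Hmul HyN ltac:(lia) ltac:(lra) HS).
cbv zeta in Q.
set (eta := (2 * INR 13 * INR (S (y ^ S J)) / T) ^ 13) in *.
assert (H6 : 0 < 6 ^ l) by (apply pow_lt; lra).
rewrite (Rabs_pos_eq (M + 130 * 6 ^ l)) in Q by lra.
assert (Hb1 : 1 <= INR (length B)).
{ apply (le_INR 1); destruct B as [|m B'] eqn:EB; [|simpl; lia].
  exfalso; assert (Hin : In 1%nat B0).
  { apply nodup_In; clear - Hy1; induction J as [|J IH]; [rewrite prods_0; left; reflexivity|].
    apply (prods_mul y J 1 1); [lia|exact IH]. }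
  exact (Hincl _ Hin). }
assert (Heta0 : 0 <= 2 * INR 13 * INR (S (y ^ S J)) / T <= / tau ^ 2).
{ pose proof (INR_S_ge1 (y ^ S J)); assert (INR 13 = 13) as -> by (simpl; ring).
  split; [apply Rdiv_le_0_compat; lra|].
  rewrite HTtau, S_INR.
  apply Rmult_le_reg_r with (tau ^ 4); [apply pow_lt; lra|].
  replace (2 * 13 * (INR (y ^ S J) + 1) / tau ^ 4 * tau ^ 4) with (26 * (INR (y ^ S J) + 1)) by (field; lra).
  replace (/ tau ^ 2 * tau ^ 4) with (tau * tau) by (field; lra); nra. }
assert (Heta1 : 0 <= eta <= / tau ^ 26).
{ split; [apply pow_le, Heta0|].
  eapply Rle_trans; [apply pow_incr, Heta0|].
  rewrite pow_inv, <- pow_mult; simpl Nat.mul; lra. }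
assert (Hetab : eta * INR (length B) <= / tau ^ 25).
{ apply Rle_trans with (/ tau ^ 26 * tau); [apply Rmult_le_compat; lra|right; field; lra]. }
apply (lower_bound_of_resonance l M (lsum (fun n => ln (INR n) ^ l / INR n) (seq 1 y))
  (lsum (fun n => ln (INR n) ^ l / INR n) (seq 1 (S (S N))))
  (INR (length B)) (INR (length B0)) eta (ln (INR y)) Z); try assumption.
- lra.
- apply Heta1.
- eapply Rle_trans; [exact Hetab|]; apply Rinv_le_contravar; [lra|].
  pose proof (pow_R1_Rle tau 24 ltac:(lra)); replace (tau ^ 25) with (tau * tau ^ 24) by ring; nra.
- assert (HAN : lsum (fun n => ln (INR n) ^ l / INR n) (seq 1 (S (S N))) <= 5 ^ l * tau ^ 24).
  { eapply Rle_trans; [apply log_weight_sum_le; lia|].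
    assert (HN5 : 1 <= INR (S (S N)) <= T ^ 5) by (split; [apply INR_S_ge1|rewrite !S_INR; lra]).
    assert (Hln : 0 <= ln (INR (S (S N))) <= 5 * x).
    { split; [apply ln_ge_0; lra|].
      replace (5 * x) with (ln (T ^ 5)) by (rewrite ln_pow by lra; fold x; simpl; ring).
      apply ln_le'; lra. }
    apply Rle_trans with (T ^ 5 * (5 ^ l * T)); [|right; rewrite HTtau; ring].
    apply Rmult_le_compat; [lra|apply pow_le; lra|lra|].
    eapply Rle_trans; [apply pow_incr; exact Hln|].
    rewrite Rpow_mult_distr; apply Rmult_le_compat_l; [apply pow_le; lra|].
    apply ln_pow_le; [exact HTe|exact HlT]. }
  apply Rle_trans with (/ tau ^ 25 * (5 ^ l * tau ^ 24)).
  + apply Rmult_le_compat; [apply Rmult_le_pos; lra| |exact Hetab|exact HAN].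
    apply lsum_nonneg; intros; apply log_weight_nonneg.
  + assert (H5 : 0 < 5 ^ l) by (apply pow_lt; lra).
    replace (/ tau ^ 25 * (5 ^ l * tau ^ 24)) with (5 ^ l * / tau) by (field; lra).
    rewrite <- (Rmult_1_r (5 ^ l)) at 2; apply Rmult_le_compat_l; [lra|].
    rewrite <- Rinv_1; apply Rinv_le_contravar; lra.
- apply lsum_nonneg; intros; apply log_weight_nonneg.
- assert (Hn0 : (1 <= 1000 <= y)%nat).
  { split; [lia|]; apply INR_le; rewrite INR_IZR_INZ; simpl Z.of_nat.
    pose proof (exp_le _ _ HZy) as Q2; rewrite exp_ln in Q2 by lra.
    pose proof (exp_ineq1_le Z); lra. }
  pose proof (log_weight_sum_ge l 1000 y Hn0) as Q2.
  eapply Rle_trans; [|exact Q2].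
  assert (E : INR 1000 = 1000) by (rewrite INR_IZR_INZ; reflexivity).
  rewrite E; replace (1 - / 1000) with (999 / 1000) by field.
  apply Rmult_le_compat_l; [lra|].
  assert (Hl10 : 0 <= ln 1000 <= 10).
  { split; [apply ln_ge_0; lra|].
    rewrite <- (ln_exp 10); apply ln_le'; [lra|].
    replace (exp 10) with (exp 1 ^ 10).
    - apply Rle_trans with (2 ^ 10); [lra|apply pow_incr].
      pose proof (exp_ineq1_le 1); lra.
    - rewrite <- Rpower_pow by apply exp_pos; unfold Rpower; rewrite ln_exp; f_equal; simpl; ring. }
  pose proof (pow_incr (ln 1000) 10 (S l) Hl10); lra.
Qed.
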